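(* There is an algorithm for the capacitated tree cover problem with edge loads which, on every instance, outputs a feasible solution whose cost is at most $3$ times the cost of an optimum solution, and which runs in time $\mathcal{O}(m\log n)$, where $n=|V|$ and $m=|E|$.
   Context: Capacitated tree cover problem with edge loads: we are given a complete graph $G=(V,E)$, metric edge costs $c:E\to\mathbb{R}_{+}$, vertex loads $b:V\to[0,1)$, metric edge loads $u:E\to\mathbb{R}_{\ge 0}$ satisfying $u(e)<u(f)\Rightarrow c(e)\le c(f)$ for all $e,f\in E$, and a facility opening cost $\gamma\ge 0$. A feasible solution is a number $k\in\mathbb{N}_{\ge1}$ together with a forest $F$ in $G$ with vertex set $V$ consisting of $k$ trees $T_1,\dots,T_k$ (so every vertex lies in exactly one tree, trees may be single vertices) such that each tree has total load $u(T_i):=\sum_{e\in E(T_i)}u(e)+\sum_{v\in V(T_i)}b(v)\le 1$. Its cost is $\sum_{e\in E(F)}c(e)+\gamma k$, and the task is to minimize the cost. *)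

(* Defs.v *)
From HB Require Import structures.
From mathcomp Require Import all_boot all_order all_algebra.
From mathcomp Require Import boolp reals exp.

Set Implicit Arguments.
Unset Strict Implicit.
Unset Printing Implicit Defensive.

Import Order.TTheory GRing.Theory Num.Theory.

Local Open Scope ring_scope.

(** * The capacitated tree cover problem with edge loads *)

Definition edges (n : nat) : {set {set 'I_n}} :=
  [set e : {set 'I_n} | #|e| == 2%N].

(* The values of [ecost] and [eload] matter only on [edges n]. *)
Record instance (R : realType) (n : nat) := Instance {
  ecost : {set 'I_n} -> R;
  eload : {set 'I_n} -> R;
  vload : 'I_n -> R;
  opening : R
}.

Definition metric (R : realType) (n : nat) (d : {set 'I_n} -> R) : Prop :=
  (forall e, e \in edges n -> 0 <= d e) /\
  (forall x y z : 'I_n, x != y -> y != z -> x != z ->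
     d [set x; z] <= d [set x; y] + d [set y; z]).

Definition wf_instance (R : realType) (n : nat) (I : instance R n) : Prop :=
  [/\ (0 < n)%N,
      metric (ecost I) /\ metric (eload I),
      (forall v, 0 <= vload I v < 1),
      (forall e f, e \in edges n -> f \in edges n ->
         eload I e < eload I f -> ecost I e <= ecost I f)
    & 0 <= opening I].

Record solution (n : nat) := Solution {
  ntrees : nat;
  forest : {set {set 'I_n}}
}.

Definition adj (n : nat) (F : {set {set 'I_n}}) : rel 'I_n :=
  fun x y => [set x; y] \in F.

Definition acyclic (n : nat) (F : {set {set 'I_n}}) : Prop :=
  forall s : seq 'I_n, (2 < size s)%N -> uniq s -> ~~ cycle (adj F) s.

(* Vertex sets of the connected components of ('I_n, F). *)
Definition trees (n : nat) (F : {set {set 'I_n}}) : {set {set 'I_n}} :=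
  equivalence_partition (connect (adj F)) [set: 'I_n].

Definition tree_load (R : realType) (n : nat) (I : instance R n)
    (F : {set {set 'I_n}}) (T : {set 'I_n}) : R :=
  \sum_(e in F | e \subset T) eload I e + \sum_(v in T) vload I v.

Definition feasible (R : realType) (n : nat) (I : instance R n)
    (S : solution n) : Prop :=
  [/\ (1 <= ntrees S)%N,
      forest S \subset edges n,
      acyclic (forest S),
      #|trees (forest S)| = ntrees S
    & forall T, T \in trees (forest S) -> tree_load I (forest S) T <= 1].

Definition cost (R : realType) (n : nat) (I : instance R n)
    (S : solution n) : R :=
  \sum_(e in forest S) ecost I e + opening I * (ntrees S)%:R.

Definition optimal (R : realType) (n : nat) (I : instance R n)
    (S : solution n) : Prop :=
  feasible I S /\ forall S', feasible I S' -> cost I S <= cost I S'.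

Lemma optimal_exists (R : realType) (n : nat) (I : instance R n) :
  wf_instance I -> exists S, optimal I S.
Proof.
move=> [n_gt0 _ b01 _ _].
pose sol F : solution n := Solution #|trees F| F.
have conn0 : connect (adj (set0 : {set {set 'I_n}})) =2 eq_op.
  move=> x y; apply/idP/eqP => [/connectP[[|z p] //= ]|->].
    by rewrite /adj inE.
  exact: connect0.
have mem0 T : T \in trees (set0 : {set {set 'I_n}}) -> exists x, T = [set x].
  move=> /imsetP[x _ ->]; exists x; apply/setP => y.
  by rewrite !inE conn0 eq_sym.
have feas0 : feasible I (sol set0).
  split => //=.
  - apply/card_gt0P; exists (pblock (trees set0) (Ordinal n_gt0)).
    apply: pblock_mem; suff -> : cover (trees set0) = [set: 'I_n] by [].
    apply: cover_partition; apply: equivalence_partitionP => x y z _ _ _.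
    by rewrite !conn0; split=> // /eqP ->.
  - exact: sub0set.
  - case=> [|x [|y [|z s]]] // _ _ /=.
    by rewrite /adj inE.
  - move=> T /mem0[x ->]; rewrite /tree_load big_pred0 => [|e]; last first.
      by rewrite inE.
    by rewrite add0r big_set1 ltW //; case/andP: (b01 x).
have /asboolP feas0b := feas0.
case: (arg_minP (fun F => cost I (sol F))
         (P := fun F => `[< feasible I (sol F) >]) (i0 := set0)) => //.
move=> F /asboolP feasF minF; exists (sol F); split=> // -[k F'] feas'.
have Ek : #|trees F'| = k by case: feas'.
by rewrite -Ek in feas' *; apply: minF; apply/asboolP.
Qed.

(** * Algorithms: programs of a real RAM *)

(* The model is a random access machine with exact real arithmetic, presented
   as a structured language.  Memory consists of natural-number registers, real
   registers, and natural-number and real arrays, all named by numbers.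
   Indices are computed from natural numbers only.  There is no conversion from
   reals to naturals (no rounding), and naturals have no unit-cost
   multiplication, so that [t] steps cannot build numbers of more than O(t)
   bits.  The only real constants are 0 and 1, so no information about an
   instance can be hidden in a program. *)

Record state (R : realType) := State {
  nreg : nat -> nat;
  rreg : nat -> R;
  narr : nat -> nat -> nat;
  rarr : nat -> nat -> R
}.

Inductive nexp :=
  | NLit of nat
  | NReg of nat
  | NGet of nat & nexp
  | NAdd of nexp & nexp
  | NSub of nexp & nexp.

Inductive rexp :=
  | RZero
  | ROne
  | RReg of nat
  | RGet of nat & nexp
  | RAdd of rexp & rexp
  | RSub of rexp & rexp
  | RMul of rexp & rexp
  | RDiv of rexp & rexp.

Inductive bexp :=
  | BNLe of nexp & nexp
  | BRLe of rexp & rexp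
  | BNot of bexp
  | BAnd of bexp & bexp.

Inductive cmd :=
  | Skip
  | NSet of nat & nexp
  | RSet of nat & rexp
  | NPut of nat & nexp & nexp
  | RPut of nat & nexp & rexp
  | Seq of cmd & cmd
  | If of bexp & cmd & cmd
  | While of bexp & cmd.

Section Semantics.
Local Open Scope nat_scope.
Variable R : realType.
Implicit Type s : state R.

Fixpoint neval s (e : nexp) : nat :=
  match e with
  | NLit k => k
  | NReg x => nreg s x
  | NGet a i => narr s a (neval s i)
  | NAdd e1 e2 => neval s e1 + neval s e2
  | NSub e1 e2 => neval s e1 - neval s e2
  end.

Fixpoint reval s (e : rexp) : R :=
  match e with
  | RZero => 0%R
  | ROne => 1%R
  | RReg x => rreg s x
  | RGet a i => rarr s a (neval s i)
  | RAdd e1 e2 => (reval s e1 + reval s e2)%R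
  | RSub e1 e2 => (reval s e1 - reval s e2)%R
  | RMul e1 e2 => (reval s e1 * reval s e2)%R
  | RDiv e1 e2 => (reval s e1 / reval s e2)%R
  end.

Fixpoint beval s (e : bexp) : bool :=
  match e with
  | BNLe e1 e2 => neval s e1 <= neval s e2
  | BRLe e1 e2 => (reval s e1 <= reval s e2)%R
  | BNot e1 => ~~ beval s e1
  | BAnd e1 e2 => beval s e1 && beval s e2
  end.

(* Number of elementary operations needed to evaluate an expression. *)
Fixpoint ntime (e : nexp) : nat :=
  match e with
  | NLit _ | NReg _ => 1
  | NGet _ i => (ntime i).+1
  | NAdd e1 e2 | NSub e1 e2 => (ntime e1 + ntime e2).+1
  end.

Fixpoint rtime (e : rexp) : nat :=
  match e with
  | RZero | ROne | RReg _ => 1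
  | RGet _ i => (ntime i).+1
  | RAdd e1 e2 | RSub e1 e2 | RMul e1 e2 | RDiv e1 e2 =>
      (rtime e1 + rtime e2).+1
  end.

Fixpoint btime (e : bexp) : nat :=
  match e with
  | BNLe e1 e2 => (ntime e1 + ntime e2).+1
  | BRLe e1 e2 => (rtime e1 + rtime e2).+1
  | BNot e1 => (btime e1).+1
  | BAnd e1 e2 => (btime e1 + btime e2).+1
  end.

Definition upd (A : Type) (f : nat -> A) (i : nat) (v : A) : nat -> A :=
  fun j => if j == i then v else f j.

Definition set_nreg s x v :=
  State (upd (nreg s) x v) (rreg s) (narr s) (rarr s).
Definition set_rreg s x v :=
  State (nreg s) (upd (rreg s) x v) (narr s) (rarr s).
Definition set_narr s a i v :=
  State (nreg s) (rreg s) (upd (narr s) a (upd (narr s a) i v)) (rarr s).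
Definition set_rarr s a i v :=
  State (nreg s) (rreg s) (narr s) (upd (rarr s) a (upd (rarr s a) i v)).

(* [exec p s t s']: started in [s], the program [p] halts in [s'] after exactly
   [t] elementary steps. *)
Inductive exec : cmd -> state R -> nat -> state R -> Prop :=
  | ExecSkip s : exec Skip s 1 s
  | ExecNSet s x e :
      exec (NSet x e) s (ntime e).+1 (set_nreg s x (neval s e))
  | ExecRSet s x e :
      exec (RSet x e) s (rtime e).+1 (set_rreg s x (reval s e))
  | ExecNPut s a i e :
      exec (NPut a i e) s (ntime i + ntime e).+1
        (set_narr s a (neval s i) (neval s e))
  | ExecRPut s a i e :
      exec (RPut a i e) s (ntime i + rtime e).+1
        (set_rarr s a (neval s i) (reval s e))
  | ExecSeq c1 c2 s t1 s1 t2 s2 :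
      exec c1 s t1 s1 -> exec c2 s1 t2 s2 ->
      exec (Seq c1 c2) s (t1 + t2).+1 s2
  | ExecIfTrue b c1 c2 s t s' :
      beval s b -> exec c1 s t s' ->
      exec (If b c1 c2) s (btime b + t).+1 s'
  | ExecIfFalse b c1 c2 s t s' :
      ~~ beval s b -> exec c2 s t s' ->
      exec (If b c1 c2) s (btime b + t).+1 s'
  | ExecWhileFalse b c s :
      ~~ beval s b -> exec (While b c) s (btime b).+1 s
  | ExecWhileTrue b c s t1 s1 t2 s2 :
      beval s b -> exec c s t1 s1 -> exec (While b c) s1 t2 s2 ->
      exec (While b c) s (btime b + t1 + t2).+1 s2.

(* The machine is deterministic: [t] is the running time and [s'] the result. *)
Lemma exec_det p s t1 s1 t2 s2 :
  exec p s t1 s1 -> exec p s t2 s2 -> t1 = t2 /\ s1 = s2.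
Proof.
move=> H1; elim: H1 t2 s2 => {p s t1 s1}.
- by move=> s t2 s2; inversion 1.
- by move=> s x e t2 s2; inversion 1.
- by move=> s x e t2 s2; inversion 1.
- by move=> s a i e t2 s2; inversion 1.
- by move=> s a i e t2 s2; inversion 1.
- move=> c1 c2 s t1 s1 t2 s2 _ IH1 _ IH2 t s'.
  inversion 1 as [ | | | | |? ? ? ? ? ? ? e1 e2| | | |]; subst.
  by have [-> ?] := IH1 _ _ e1; subst; have [-> ->] := IH2 _ _ e2.
- move=> b c1 c2 s t s' hb _ IH t2 s2.
  inversion 1 as [ | | | | | |? ? ? ? ? ? h e|? ? ? ? ? ? h e| |]; subst.
    by have [-> ->] := IH _ _ e.
  by case/negP: h.
- move=> b c1 c2 s t s' hb _ IH t2 s2.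
  inversion 1 as [ | | | | | |? ? ? ? ? ? h e|? ? ? ? ? ? h e| |]; subst.
    by case/negP: hb.
  by have [-> ->] := IH _ _ e.
- move=> b c s hb t2 s2.
  inversion 1 as [ | | | | | | | |? ? ? h|? ? ? ? ? ? ? h e1 e2]; subst => //.
  by case/negP: hb.
- move=> b c s t1 s1 t2 s2 hb _ IH1 _ IH2 t s'.
  inversion 1 as [ | | | | | | | |? ? ? h|? ? ? ? ? ? ? h e1 e2]; subst.
    by case/negP: h.
  by have [-> ?] := IH1 _ _ e1; subst; have [-> ->] := IH2 _ _ e2.
Qed.

End Semantics.

(** * Input and output conventions *)

(* The instance is given by n, gamma, the list of vertex loads and the n * n
   matrices (stored by rows) of edge costs and edge loads.  The rest of the
   memory, the diagonals included, is uninitialised: its content is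
   arbitrary. *)
Definition input (R : realType) (n : nat) (I : instance R n)
    (s : state R) : Prop :=
  [/\ nreg s 0 = n,
      rreg s 0 = opening I,
      (forall v : 'I_n, rarr s 0 v = vload I v),
      (forall x y : 'I_n, x != y ->
         rarr s 1 (x * n + y)%N = ecost I [set x; y])
    & (forall x y : 'I_n, x != y ->
         rarr s 2 (x * n + y)%N = eload I [set x; y])].

(* The solution is returned as the number of trees, the number of edges of the
   forest, and the list [l] of those edges, without repetition, the two end
   points of an edge being stored in two arrays. *)
Definition output (R : realType) (n : nat) (s : state R)
    (S : solution n) : Prop :=
  nreg s 0 = ntrees S /\
  exists l : seq ('I_n * 'I_n),
    [/\ [seq (narr s 0 i, narr s 1 i) | i <- iota 0 (nreg s 1)]
          = [seq (val e.1, val e.2) | e <- l],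
        uniq [seq [set e.1; e.2] | e <- l]
      & forest S = [set e | e \in [seq [set e.1; e.2] | e <- l]]].

(* Up to the constant this is m log n for n >= 2; the maximum with 1 only
   matters for constantly many n, and is needed because m log n = 0 if n = 1. *)
Definition m_log_n (R : realType) (n : nat) : R :=
  Num.max 1 (#|edges n|%:R * ln n%:R).

(* Main.v *)
(* Since [u(e) < u(f)] implies [c(e) <= c(f)], the key [c + u] orders the edges
   so that both [c] and [u] are monotone, and one minimum spanning tree for this
   key (found by Prim's algorithm in quadratic time) is minimal for both.  Each
   feasible forest has total load at most its number of trees, so exchanging its
   edges for tree edges shows that its cost is at least [c(F) + gamma (n - |F|)],
   where [F] is the longest prefix of the sorted tree edges with
   [b(V) + u(F) + |F| <= n] and [c(e) <= gamma].

   Every tree of [F] is laid out as a path by inserting each vertex right after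
   its Prim parent; by the triangle inequality this at most doubles [c] and [u].
   The paths are cut greedily into segments of load at most 1.  Two consecutive
   segments with the link between them overflow, so there are at most
   [(n - |F|) + 2 (u(F) + b(V)) <= 3 (n - |F|)] segments, and the result costs
   at most [2 c(F) + 3 gamma (n - |F|)]. *)

Require Import Defs.
From mathcomp Require Import all_boot all_order all_algebra.
From mathcomp Require Import reals exp.
From mathcomp Require Import zify lra.

Set Implicit Arguments.
Unset Strict Implicit.
Unset Printing Implicit Defensive.

Import Order.TTheory GRing.Theory Num.Theory.

Local Open Scope ring_scope.

(** * Minimum spanning trees bound feasible forests *)

(** The lower bound is a relaxation. A solution with k trees is remembered only through a set [K] of
    n - k tree edges, named by their child vertices, with u(K) + b(V) <= n - |K|. Since c and u grow
    along one common order, the greedy prefix [kept] solves the problem of minimising c(K) + gamma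
    (n - |K|) exactly. The capacity inequality of this optimum is used a second time to count
    segments.

    As G is complete, m log n dominates n^2. Hence nothing has to be sorted: every prefix sum is
    recomputed from scratch.

    Paths replace trees because cutting a path needs only one scan with a running load. All paths
    sit in one list, so acyclicity and components become statements about positions in that list.

    Memory starts with arbitrary contents, matrix diagonals included, so every matrix read must come
    with a proof that its two vertices differ. *)

Lemma set2_inj (T : finType) (a b x y : T) :
  [set a; b] = [set x; y] -> (a = x /\ b = y) \/ (a = y /\ b = x).
Proof.
move=> E; have /set2P[] : a \in [set x; y] by rewrite -E set21.
  move=> ax; left; split=> //; have : y \in [set a; b] by rewrite E set22.
  have : b \in [set x; y] by rewrite -E set22.
  by rewrite ax => /set2P[->|//] /set2P[].
move=> ay; right; split=> //; have : x \in [set a; b] by rewrite E set21.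
have : b \in [set x; y] by rewrite -E set22.
by rewrite ay => /set2P[//|->] /set2P[].
Qed.

Section Graphs.
Variable n : nat.
Implicit Types (F H : {set {set 'I_n}}) (S : seq 'I_n).

Lemma adj_sym F : symmetric (adj F).
Proof. by move=> x y; rewrite /adj setUC. Qed.

Lemma connect_adj_sym F : connect_sym (adj F).
Proof. exact/sym_connect_sym/adj_sym. Qed.

Lemma connect_adj_equiv F :
  {in [set: 'I_n] & &, equivalence_rel (connect (adj F))}.
Proof.
move=> x y z _ _ _; split; first exact: connect0.
by move=> xy; rewrite (same_connect (connect_adj_sym F) xy).
Qed.

Lemma trees_partition F : partition (trees F) [set: 'I_n].
Proof. exact/equivalence_partitionP/connect_adj_equiv. Qed.

Lemma mem_tree F x y :
  (y \in pblock (trees F) x) = connect (adj F) x y.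
Proof.
by apply: pblock_equivalence_partition; rewrite ?inE //; exact: connect_adj_equiv.
Qed.

Lemma pblock_trees F x : pblock (trees F) x \in trees F.
Proof. by rewrite pblock_mem // (cover_partition (trees_partition F)) inE. Qed.

(* Deletes the edge by which a simple path from [p] to [v] first leaves [S]. *)
Lemma exchange_edge H S p v : p \in S -> v \notin S ->
    (forall a b, connect (adj H) a b) ->
  exists x y, [/\ x \in S, y \notin S, [set x; y] \in H
    & forall a b, connect (adj (H :\ [set x; y] :|: [set [set p; v]])) a b].
Proof.
move=> pS vS conn; have /connectP[q0 pq0 Ev] := conn p v.
case/shortenP: pq0 Ev => q pq uq _ Ev.
have : has [predC S] q.
  apply/hasP; exists v => //.
  have := mem_last p q; rewrite -Ev inE => /predU1P[E|//].
  by move: vS; rewrite E pS.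
move=> hq; case: (split_find hq) pq uq Ev => y q1 q2 yS q1S.
have {}q1S : all [in S] q1 by rewrite -[all _ _]negbK -has_predC.
rewrite cat_path last_cat last_rcons rcons_path -cat_cons cat_uniq.
move=> /andP[/andP[pq1 xy] pq2] /and3P[_ disj uq2] Ev.
have all1 : all [in S] (p :: q1) by rewrite /= pS.
set x := last p q1 in xy *.
have xp1 : x \in p :: q1 by exact: mem_last.
have xS : x \in S by apply: (allP all1).
exists x, y; split => //; set H' := _ :|: _.
have keep a b : [set a; b] \in H -> [set a; b] != [set x; y] -> adj H' a b.
  by move=> abH abE; rewrite /adj !inE abE abH.
have cpx : connect (adj H') p x.
  apply/connectP; exists q1 => //.
  apply: (sub_in_path (P := [in S]) (e := adj H)) => // a b aS bS abH.
  apply: keep => //; apply/eqP => /set2_inj[] [Ea Eb];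
    by move: yS; rewrite /= -?Ea -?Eb /= ?aS ?bS.
(* The path is simple, so its tail never returns to [x] and cannot use the deleted edge; the first
   part stays in [S] and cannot use it either. *)
have cyv : connect (adj H') y v.
  apply/connectP; exists q2 => //.
  apply: (sub_in_path (P := predC1 x) (e := adj H)) => // [a b aS bS abH|].
    apply: keep => //; apply/eqP => /set2_inj[] [Ea Eb]; subst;
      by move: aS bS; rewrite !inE ?Ea ?Eb ?eqxx ?andbF.
  apply/allP => z; rewrite inE => /predU1P[->|zq]; apply/eqP => zx.
    by move: yS; rewrite /= zx xS.
  move/hasPn: disj => /(_ z zq); rewrite zx -rcons_cons mem_rcons inE.
  by rewrite /= xp1 orbT.
have cpv : connect (adj H') p v by apply: connect1; rewrite /adj !inE eqxx orbT.
have cxy : connect (adj H') x y.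
  apply: connect_trans (connect_trans _ cpv) _; rewrite connect_adj_sym //.
have sub : subrel (adj H) (connect (adj H')).
  move=> a b abH; have [/set2_inj[] [-> ->] //|ne] :=
    eqVneq [set a; b] [set x; y].
    by rewrite connect_adj_sym.
  by apply: connect1; exact: keep.
by move=> a b; apply: (connect_sub sub).
Qed.

End Graphs.

Section Pairs.
Variables (R : realType) (n : nat) (I : instance R n).

Definition ecst (x y : 'I_n) := ecost I [set x; y].
Definition elod (x y : 'I_n) := eload I [set x; y].
Definition key (x y : 'I_n) := ecst x y + elod x y.

Hypothesis wfI : wf_instance I.

Lemma pair_edge (x y : 'I_n) : x != y -> [set x; y] \in edges n.
Proof. by move=> xy; rewrite inE cards2 xy. Qed.

Lemma edgeP (e : {set 'I_n}) :
  e \in edges n -> exists x y, x != y /\ e = [set x; y].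
Proof. by rewrite inE => /cards2P[x [y [xy E]]]; exists x, y. Qed.

Lemma ecost_ge0 e : e \in edges n -> 0 <= ecost I e.
Proof. by case: wfI => _ [[h _] _] _ _ _; apply: h. Qed.

Lemma eload_ge0 e : e \in edges n -> 0 <= eload I e.
Proof. by case: wfI => _ [_ [h _]] _ _ _; apply: h. Qed.

(** Trichotomy on the loads: a smaller load orders the costs the same way, equal loads leave the key
    to the costs, and a larger load would make the key larger. *)
Lemma key_le x y x' y' : x != y -> x' != y' -> key x y <= key x' y' ->
  ecst x y <= ecst x' y' /\ elod x y <= elod x' y'.
Proof.
move=> /pair_edge xy /pair_edge xy'; rewrite /key /ecst /elod => le.
case: wfI => _ _ _ mono _; have m1 := mono _ _ xy xy'; have m2 := mono _ _ xy' xy.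
case: (ltgtP (eload I [set x; y]) (eload I [set x'; y'])) => h.
- by split; [exact: m1 | ].
- by have := m2 h; lra.
- by split; lra.
Qed.

End Pairs.

(** * Prim trees and the exchange of forest edges for tree edges *)

Section Prim.
Variables (R : realType) (n' : nat).
Local Notation n := n'.+1.
Variable I : instance R n.
Hypothesis wfI : wf_instance I.

(* [os] lists the vertices in reverse order of insertion. *)
Inductive prim (par : 'I_n -> 'I_n) : seq 'I_n -> Prop :=
  | PrimRoot : prim par [:: ord0]
  | PrimStep os v : prim par os -> v \notin os -> par v \in os ->
      (forall x y, x \in os -> y \notin os -> key I (par v) v <= key I x y) ->
      prim par (v :: os).

Lemma prim_root par os : prim par os -> ord0 \in os.
Proof. by elim=> [|os' v _ IH _ _ _]; rewrite inE ?eqxx // IH orbT. Qed.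

Lemma prim_uniq par os : prim par os -> uniq os.
Proof. by elim=> // os' v _ /= -> ->. Qed.

Lemma prim_full par os : prim par os -> size os = n -> forall v, v \in os.
Proof.
move=> pos sz v; have sub : {subset os <= enum 'I_n} by move=> x; rewrite mem_enum.
have [|_ ->] := uniq_min_size (prim_uniq pos) sub; last by rewrite mem_enum.
by rewrite -cardE card_ord sz.
Qed.

(** Relaxation changes only parents of unvisited vertices, so the tree built so far survives it. *)
Lemma prim_eq_in par par' os :
  {in os, par =1 par'} -> prim par os -> prim par' os.
Proof.
move=> eq pos; elim: pos eq => [|{}os v _ IH vos pvos min] eq.
  exact: PrimRoot.
have Ev : par v = par' v by apply: eq; rewrite inE eqxx.
apply: PrimStep; rewrite -?Ev //.
by apply: IH => x xos; apply: eq; rewrite inE xos orbT.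
Qed.

Lemma prim_par_neq par os v : prim par os -> v \in os -> v != ord0 ->
  par v != v.
Proof.
elim=> [|{}os w pos IH wos pwos _]; first by rewrite inE => ->.
rewrite inE => /predU1P[->|vos] v0; last exact: IH.
by apply: contraNneq wos => E; rewrite -[X in X \in _]E.
Qed.

Definition tree_edges (par : 'I_n -> 'I_n) (os : seq 'I_n) : {set {set 'I_n}} :=
  [set [set par v; v] | v in [pred v in os | v != ord0]].

(* [X] makes [F] connected.  Replacing crossing edges of [F :|: X] by tree edges
   one at a time, [K] collects the tree edges that replaced an edge of [F]. *)
Lemma prim_exchange par os (F X : {set {set 'I_n}}) : prim par os ->
  F \subset edges n -> (forall a b, connect (adj (F :|: X)) a b) ->
  exists (G Y : {set {set 'I_n}}) (K : {set 'I_n}),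
  [/\ G \subset F /\ {subset K <= os}, ord0 \notin K,
    forall a b, connect (adj (tree_edges par os :|: G :|: Y)) a b,
    \sum_(v in K) ecst I (par v) v + \sum_(e in G) ecost I e
      <= \sum_(e in F) ecost I e /\
    \sum_(v in K) elod I (par v) v + \sum_(e in G) eload I e
      <= \sum_(e in F) eload I e
  & (#|Y| + size os <= #|K| + #|X| + 1)%N].
Proof.
move=> + Fe conn; elim=> [|{}os v pos [G [Y [K [[GF Kos] K0 conn' [c_le u_le] card]]]] vos pvos min].
  exists F, X, set0; split; rewrite ?big_set0 ?add0r ?cards0 ?inE //=.
  - by split=> // x; rewrite inE.
  - have -> : tree_edges par [:: ord0] = set0.
      apply/setP => e; rewrite inE; apply/negbTE/imsetP => -[v].
      by rewrite !inE andbN.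
    by rewrite set0U.
have v0 : v != ord0 by apply: contraNneq vos => ->; apply: prim_root pos.
have vK : v \notin K by apply: contra vos; apply: Kos.
have [x [y [xos yos xyH conn2]]] := exchange_edge pvos vos conn'.
have nxy : x != y by apply: contraNneq yos => <-.
have te_v : [set par v; v] \in tree_edges par (v :: os).
  by apply/imsetP; exists v; rewrite // !inE eqxx.
have te_sub e : e \in tree_edges par os -> e \in tree_edges par (v :: os).
  case/imsetP=> w; rewrite !inE => /andP[wos w0] ->.
  by apply/imsetP; exists w; rewrite // !inE wos w0 orbT.
have weaken (G' Y' : {set {set 'I_n}}) :
    {subset (tree_edges par os :|: G :|: Y) :\ [set x; y]
       <= tree_edges par (v :: os) :|: G' :|: Y'} ->
    forall a b, connect (adj (tree_edges par (v :: os) :|: G' :|: Y')) a b.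
  move=> sub a b; apply: connect_sub (conn2 a b) => p q; rewrite {1}/adj => pq.
  apply: connect1; rewrite /adj; case/setUP: pq => [/sub //|/set1P->].
  by rewrite !inE te_v.
(* Either the crossing edge stems from [F] and [v] enters [K], or it stems from [X] and [Y] shrinks;
   both preserve the cardinality inequality as [os] grows by one. *)
have [xyG|xyG] := boolP ([set x; y] \in G).
  have le := key_le wfI (prim_par_neq (PrimStep pos vos pvos min) (mem_head _ _) v0)
    nxy (min _ _ xos yos).
  exists (G :\ [set x; y]), Y, (v |: K); split.
  - split; first by rewrite (subset_trans _ GF) // subD1set.
    by move=> z /setU1P[->|/Kos]; rewrite inE ?eqxx // => ->; rewrite orbT.
  - by rewrite !inE negb_or eq_sym v0.
  - apply: weaken => e; rewrite !inE => /andP[ne].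
    by case/orP=> [/orP[/te_sub->|->]|->]; rewrite ?ne ?orbT.
  - move: le c_le u_le; rewrite !(big_setU1 _ vK) /= !(big_setD1 _ xyG) /=.
    by rewrite /ecst /elod; lra.
  - by rewrite cardsU1 vK /= addnS -[X in (_ < X)%N]addnA add1n addSn ltnS addnA.
(* Tree edges have both ends in [os], so none of them crosses. *)
have xyY : [set x; y] \in Y.
  move: xyH; rewrite !inE (negbTE xyG) orbF => /orP[/imsetP[w]|//].
  rewrite !inE => /andP[wos w0] E.
  have pwos : par w \in os.
    elim: pos wos {conn2 weaken te_sub conn' Kos card te_v min vos pvos xos yos}
      w0 => [|{}os z _ IH _ pz _]; first by rewrite inE => /eqP->; rewrite eqxx.
    rewrite inE => /predU1P[->|/IH h /h ph]; first by rewrite inE pz orbT.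
    by rewrite inE ph orbT.
  have : y \in [set par w; w] by rewrite -E set22.
  by move=> /set2P[] Ey; move: yos; rewrite Ey ?wos ?pwos.
exists G, (Y :\ [set x; y]), K; split => //.
- by split=> // z /Kos; rewrite inE => ->; rewrite orbT.
- apply: weaken => e; rewrite !inE => /andP[ne].
  by case/orP=> [/orP[/te_sub->|->]|->]; rewrite ?ne ?orbT.
- by move: card; rewrite (cardsD1 [set x; y] Y) xyY /= add1n addSn -addnS.
Qed.

(** A star from [ord0] to one representative of every other tree. *)
Lemma connecting_edges (F : {set {set 'I_n}}) :
  exists X : {set {set 'I_n}}, (forall a b, connect (adj (F :|: X)) a b) /\
    (#|X| < #|trees F|)%N.
Proof.
pose rep (T : {set 'I_n}) := odflt ord0 [pick x in T].
have repP (T : {set 'I_n}) x : x \in T -> rep T \in T.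
  by rewrite /rep; case: pickP => //= h xT; rewrite h in xT.
pose X := [set [set ord0; rep T] | T in trees F :\ pblock (trees F) ord0].
exists X; split; last first.
  apply: leq_ltn_trans (leq_imset_card _ _) _.
  by rewrite (cardsD1 (pblock (trees F) ord0) (trees F)) pblock_trees.
have sub a b : connect (adj F) a b -> connect (adj (F :|: X)) a b.
  by apply: connect_sub => p q pq; apply: connect1; rewrite /adj inE; apply/orP; left.
suff conn0 a : connect (adj (F :|: X)) ord0 a.
  by move=> a b; apply: connect_trans (conn0 b); rewrite connect_adj_sym.
have [E|ne] := eqVneq (pblock (trees F) a) (pblock (trees F) ord0).
  by apply: sub; rewrite -mem_tree -E mem_tree connect0.
have aa : a \in pblock (trees F) a by rewrite mem_tree.
have := repP _ _ aa; rewrite mem_tree => ar.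
apply: (@connect_trans _ _ (rep (pblock (trees F) a))); last first.
  by apply: sub; rewrite connect_adj_sym.
apply: connect1; rewrite /adj inE; apply/orP; right; apply/imsetP.
by exists (pblock (trees F) a); rewrite // !inE ne pblock_trees.
Qed.

(** One and the same [K] must serve cost and load, since [kept_optimal] compares costs under the
    load constraint. *)
Lemma prim_lower par os (F : {set {set 'I_n}}) : prim par os -> size os = n ->
    F \subset edges n ->
  exists K : {set 'I_n}, [/\ ord0 \notin K, (#|K| + #|trees F|)%N = n,
    \sum_(v in K) ecst I (par v) v <= \sum_(e in F) ecost I e
  & \sum_(v in K) elod I (par v) v <= \sum_(e in F) eload I e].
Proof.
move=> pos sz Fe; have [X [conn cX]] := connecting_edges F.
have [G [Y [K [[GF Kos] K0 _ [c_le u_le] card]]]] := prim_exchange pos Fe conn.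
have ge0 (d : {set 'I_n} -> R) (A : {set {set 'I_n}}) :
    A \subset edges n -> (forall e, e \in edges n -> 0 <= d e) ->
    0 <= \sum_(e in A) d e.
  by move=> /subsetP Ae d0; apply: sumr_ge0 => e /Ae /d0.
have Ge := subset_trans GF Fe.
have cG := ge0 _ _ Ge (ecost_ge0 wfI); have uG := ge0 _ _ Ge (eload_ge0 wfI).
have kn : (#|trees F| <= n)%N.
  by apply: leq_trans (leq_imset_card _ _) _; rewrite cardsT card_ord.
pose K' := [set x in take (n - #|trees F|) (enum K)].
have K'K : K' \subset K.
  by apply/subsetP => x; rewrite inE => /mem_take; rewrite mem_enum.
have cK' : #|K'| = (n - #|trees F|)%N.
  rewrite cardsE (card_uniqP _) ?take_uniq ?enum_uniq //.
  rewrite size_takel // -cardE leq_subLR addnC.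
  apply: (@leq_trans (#|K| + #|X| + 1)).
    by move: (leq_trans (leq_addl #|Y| _) card); rewrite sz.
  by rewrite -addnA leq_add2l addn1.
have pK v : v \in K -> par v != v.
  move=> vK; apply: (prim_par_neq pos); first exact: Kos.
  by apply: contraNneq K0 => <-.
have mono (d : 'I_n -> R) : (forall v, v \in K -> 0 <= d v) ->
    \sum_(v in K') d v <= \sum_(v in K) d v.
  move=> d0; rewrite (big_setID K' d (A := K)) /= (setIidPr K'K) lerDl.
  by apply: sumr_ge0 => v /setDP[/d0].
exists K'; split.
- by apply: contra K0; apply: (subsetP K'K).
- by rewrite cK' subnK.
- apply: le_trans (mono _ _) _; last by lra.
  by move=> v /pK /pair_edge /(ecost_ge0 wfI).
- apply: le_trans (mono _ _) _; last by lra.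
  by move=> v /pK /pair_edge /(eload_ge0 wfI).
Qed.

(** Adds the bound 1 over all trees: they partition the vertices, and each edge lies inside the
    component of its ends. *)
Lemma feasible_load (S : solution n) : feasible I S ->
  \sum_(e in forest S) eload I e + \sum_v vload I v <= (ntrees S)%:R.
Proof.
case=> _ Fe _ <- le1; set F := forest S in Fe le1 *.
have : \sum_(T in trees F) tree_load I F T <= \sum_(T in trees F) 1.
  exact: ler_sum.
rewrite sumr_const; apply: le_trans; rewrite /tree_load big_split /=.
apply: lerD; last first.
  have /and3P[_ tI _] := trees_partition F.
  rewrite -big_trivIset //= (cover_partition (trees_partition F)) /=.
  by rewrite [leRHS](eq_bigl predT) // => x; rewrite inE.
rewrite (exchange_big_dep [in F]) /=; last by move=> T e _ /andP[].
apply: ler_sum => e eF; have /edgeP[x [y [xy Ee]]] := subsetP Fe e eF.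
rewrite (bigD1 (pblock (trees F) x)) /=; last first.
  rewrite pblock_trees eF Ee subUset !sub1set !mem_tree connect0 connect1 //.
  by rewrite /adj -Ee.
rewrite lerDl; apply: sumr_ge0 => *; exact/(eload_ge0 wfI)/(subsetP Fe).
Qed.

End Prim.

(** Take [t] with the fewest predecessors in [A]. The predecessors of an [i] preceding [t] are among
    those of [t], hence equal to them, so [t] precedes [i] as well. *)
Lemma total_least (T : finType) (r : rel T) (A : {set T}) t0 :
  total r -> transitive r -> t0 \in A -> exists2 t, t \in A & {in A, forall i, r t i}.
Proof.
move=> tot tr At0; pose rk t := #|[set j in A | r j t]|.
case: (arg_minnP rk At0) => t At min; exists t => // i Ai.
have [//|rit] := orP (tot t i).
have sub : [set j in A | r j i] \subset [set j in A | r j t].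
  by apply/subsetP => j; rewrite !inE => /andP[-> /tr]; apply.
have /eqP E : [set j in A | r j i] == [set j in A | r j t].
  by rewrite eqEcard sub; exact: min.
have : t \in [set j in A | r j t] 
    by apply/setIdP; split=> //; have := tot t t; rewrite orbb.
by rewrite -E inE => /andP[].
Qed.

(** * The greedy prefix of tree edges and its optimality *)

Section Threshold.
Variables (R : realType) (n' : nat).
Local Notation n := n'.+1.
Variable I : instance R n.
Variable par : 'I_n -> 'I_n.

Definition pkey v := key I (par v) v.

(* Ties between equal keys are broken by the index of the child vertex; the
   shape of the formula is that of the test in the program. *)
Definition before (j i : 'I_n) :=
  ~~ ((pkey i <= pkey j) && ~~ ((pkey j <= pkey i) && (j <= i)%N)).

(** This is b(V) - n, in a form the machine can accumulate: it cannot convert the natural number n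
    to a real. *)
Definition slack := \sum_v (vload I v - 1).

(** The sum includes [v] itself, as [before] is reflexive. The middle test thus reads b(V) + u +
    count <= n for the prefix ending at [v]. *)
Definition kept (v : 'I_n) := [&& v != ord0,
  slack + \sum_(j | (j != ord0) && before j v) (1 + elod I (par j) j) <= 0
  & ecst I (par v) v <= opening I].

Lemma beforeE j i : before j i = (pkey j < pkey i) || ((pkey j == pkey i) && (j <= i)%N).
Proof. by rewrite /before; case: ltgtP => //= _; rewrite ?andbF ?negbK. Qed.

Lemma before_total : total before.
Proof.
by move=> j i; rewrite !beforeE; case: ltgtP => //= _; exact: leq_total.
Qed.

Lemma before_trans : transitive before.
Proof.
move=> i j k; rewrite !beforeE => /orP[ji|/andP[/eqP-> ji]] /orP[ik|/andP[/eqP<- ik]].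
- by rewrite (lt_trans ji ik).
- by rewrite ji.
- by rewrite ik.
- by rewrite eqxx (leq_trans ji ik) orbT.
Qed.

Lemma before_anti j i : before j i -> before i j -> j = i.
Proof.
rewrite !beforeE; case: ltgtP => //= _ ji ij.
by apply/val_inj/anti_leq; rewrite ji ij.
Qed.

Hypothesis wfI : wf_instance I.
Hypothesis par_neq : forall v, v != ord0 -> par v != v.

Let c v := ecst I (par v) v.
Let u v := elod I (par v) v.
Let g := opening I.

Lemma before_le j i : j != ord0 -> i != ord0 -> before j i -> c j <= c i /\ u j <= u i.
Proof.
move=> /par_neq pj /par_neq pi; rewrite beforeE => h.
apply: (key_le wfI) => //; case/orP: h => [/ltW//|/andP[/eqP h _]].
by rewrite -/(pkey j) h.
Qed.

Lemma par_load_ge0 v : v != ord0 -> 0 <= u v.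
Proof. by move=> /par_neq/pair_edge/(eload_ge0 wfI). Qed.

Lemma par_cost_ge0 v : v != ord0 -> 0 <= c v.
Proof. by move=> /par_neq/pair_edge/(ecost_ge0 wfI). Qed.

Let prefix v := \sum_(j | (j != ord0) && before j v) (1 + u j).

Lemma ler_sum_subset (P Q : pred 'I_n) (f : 'I_n -> R) :
  (forall j, P j -> Q j) -> (forall j, Q j -> 0 <= f j) ->
  \sum_(j | P j) f j <= \sum_(j | Q j) f j.
Proof.
move=> PQ f0; rewrite (bigID P Q) /=.
rewrite (eq_bigl P) => [|j]; first by rewrite lerDl sumr_ge0 // => j /andP[/f0].
by apply/andP/idP => [[]|Pj] //; split=> //; exact: PQ.
Qed.

Lemma kept_neq0 v : kept v -> v != ord0.
Proof. by case/and3P. Qed.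

(** Both tests are monotone along [before], the summands 1 + u being nonnegative; hence the kept
    vertices form a prefix. *)
Lemma kept_before j i : j != ord0 -> before j i -> kept i -> kept j.
Proof.
move=> j0 ji /and3P[i0 cap ci]; apply/and3P; split=> //; last first.
  exact: le_trans (proj1 (before_le j0 i0 ji)) ci.
apply: le_trans cap; rewrite lerD2l; apply: ler_sum_subset => k.
  by case/andP=> -> /before_trans; apply.
by case/andP=> /par_load_ge0; rewrite /u => h _; lra.
Qed.

Let F := [set v | kept v].

(** The prefix tested at the last kept vertex [t], found as a least element of the reversed order,
    contains all of [F]. If [F] is empty, the bound is b(V) <= n. *)
Lemma kept_capacity : \sum_(v in F) u v + \sum_v vload I v <= n%:R - #|F|%:R.
Proof.
have ES : slack = \sum_v vload I v - n%:R.
  by rewrite /slack big_split /= sumrN sumr_const card_ord.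
have [F0|[v0 v0F]] := set_0Vmem F.
  rewrite F0 big_set0 cards0 add0r subr0.
  have <- : \sum_(v < n) (1 : R) = n%:R by rewrite sumr_const card_ord.
  by apply: ler_sum => v _; case: wfI => _ _ /(_ v)/andP[_ /ltW].
have [t tF max] := @total_least _ (fun x y => before y x) F v0
  (fun x y => before_total y x) (fun x y z a b => before_trans b a) v0F.
have : slack + prefix t <= 0 by move: tF; rewrite inE => /and3P[].
suff le : \sum_(v in F) u v + #|F|%:R <= prefix t by rewrite ES; lra.
rewrite -sumr_const -big_split /= /prefix.
under eq_bigr do rewrite addrC.
apply: ler_sum_subset => j.
  by move=> jF; rewrite max // andbT; apply: kept_neq0; rewrite inE in jF.
by case/andP=> /par_load_ge0 => h _; lra.
Qed.

(* Exchange argument: every rejected vertex of [K] comes after the first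
   rejected vertex [t], every kept vertex before it; [t] was rejected because
   its edge is dearer than an opening, or because the capacity is exhausted. *)
Lemma kept_optimal (K : {set 'I_n}) : ord0 \notin K ->
  \sum_(v in K) u v + \sum_v vload I v <= n%:R - #|K|%:R ->
  \sum_(v in F) c v + g * (n%:R - #|F|%:R)
    <= \sum_(v in K) c v + g * (n%:R - #|K|%:R).
Proof.
move=> K0 cap.
have ES : slack = \sum_v vload I v - n%:R.
  by rewrite /slack big_split /= sumrN sumr_const card_ord.
have Kn0 v : v \in K -> v != ord0 by apply: contraTneq => ->.
have cardS (A : {set 'I_n}) (x : R) : #|A|%:R * x = \sum_(v in A) x.
  by rewrite sumr_const mulr_natl.
(* With the common g n removed, choosing [v] is worth c v - g. *)
suff : \sum_(v in F) (c v - g) <= \sum_(v in K) (c v - g).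
  by rewrite !sumrB -!cardS; lra.
rewrite (big_setID K) [leRHS](big_setID F) /= setIC lerD2l.
have FD_le0 : \sum_(v in F :\: K) (c v - g) <= 0.
  by apply: sumr_le0 => v /setDP[]; rewrite inE => /and3P[_ _]; rewrite -/(c v) -/g; lra.
have [KF|[v0 v0K]] := set_0Vmem (K :\: F); first by rewrite KF big_set0.
pose N := [set v | (v != ord0) && ~~ kept v].
have KN v : v \in K :\: F -> v \in N.
  by case/setDP=> vK; rewrite !inE => ->; rewrite Kn0.
have [t tN min] := total_least before_total before_trans (KN _ v0K).
have := tN; rewrite inE => /andP[t0 nt].
have Ft v : v \in F -> before v t.
  rewrite inE => vF; have [//|tv] := orP (before_total v t).
  by case/negP: nt; apply: kept_before tv vF.
have hi v : v \in K :\: F -> c t <= c v /\ u t <= u v.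
  move=> /KN vN; apply: before_le => //; last exact: min.
  by move: vN; rewrite inE => /andP[].
have lo v : v \in F :\: K -> c v <= c t /\ u v <= u t.
  case/setDP=> vF _; apply: before_le (Ft _ vF) => //.
  by apply: kept_neq0; rewrite inE in vF.
have [ct|ct] := ltP g (c t).
  apply: (le_trans FD_le0); apply: sumr_ge0 => v /hi[]; lra.
have over : 0 < slack + prefix t.
  by move: nt; rewrite /kept t0 -/(c t) -/g ct andbT -ltNge.
have prefix_le : prefix t <= \sum_(v in F) (1 + u v) + (1 + u t).
  have tF : t \notin F by rewrite inE.
  rewrite addrC -big_setU1 //=; apply: ler_sum_subset => j; last first.
    rewrite !inE => /predU1P[->|/kept_neq0] ; last by move/par_load_ge0; lra.
    by move: (par_load_ge0 t0); lra.
  case/andP=> j0 jt; rewrite !inE; have [//|nj] := boolP (kept j).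
    by rewrite orbT.
  by apply/orP; left; apply/eqP/before_anti => //; apply: min; rewrite inE j0.
have capK : slack + \sum_(v in K) (1 + u v) <= 0.
  by rewrite big_split /= -cardS mulr1 ES; lra.
have ut0 := par_load_ge0 t0.
(* [K] fits while [F] together with [t] overflows. Members of K \ F weigh at least 1 + u t and those
   of F \ K at most that, so |K \ F| < |F \ K| + 1. *)
have cardle : (#|K :\: F| <= #|F :\: K|)%N.
  suff : #|K :\: F|%:R * (1 + u t) < (#|F :\: K|.+1)%:R * (1 + u t).
    by rewrite ltr_pM2r ?ltr_nat ?ltnS //; lra.
  have h1 : #|K :\: F|%:R * (1 + u t) <= \sum_(v in K :\: F) (1 + u v).
    by rewrite cardS; apply: ler_sum => v /hi[]; lra.
  have h2 : \sum_(v in F :\: K) (1 + u v) <= #|F :\: K|%:R * (1 + u t).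
    by rewrite cardS; apply: ler_sum => v /lo[]; lra.
  have eF : \sum_(v in F) (1 + u v) =
      \sum_(v in F :&: K) (1 + u v) + \sum_(v in F :\: K) (1 + u v).
    exact: big_setID.
  have eK : \sum_(v in K) (1 + u v) =
      \sum_(v in F :&: K) (1 + u v) + \sum_(v in K :\: F) (1 + u v).
    by rewrite (big_setID F) setIC.
  by rewrite -natr1 mulrDl mul1r; lra.
apply: (@le_trans _ _ (#|F :\: K|%:R * (c t - g))).
  by rewrite cardS; apply: ler_sum => v /lo[]; lra.
(* Here c t - g <= 0, so more copies give a smaller product. *)
apply: (@le_trans _ _ (#|K :\: F|%:R * (c t - g))).
  by rewrite ler_wnM2r ?ler_nat //; lra.
by rewrite cardS; apply: ler_sum => v /hi[]; lra.
Qed.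

End Threshold.

(** The set [K] from [prim_lower] inherits the capacity inequality from [feasible_load], so it
    competes with [F] in [kept_optimal]. *)
Lemma kept_lower (R : realType) n' (I : instance R n'.+1) par os (S : solution n'.+1)
    (F := [set v | kept I par v]) :
  wf_instance I -> prim I par os -> size os = n'.+1 -> feasible I S ->
  \sum_(v in F) ecst I (par v) v + opening I * (n'.+1%:R - #|F|%:R) <= cost I S.
Proof.
move=> wfI pos sz feas; have [_ Fe _ kE _] := feas.
have full := prim_full pos sz.
have pn v : v != ord0 -> par v != v by apply: prim_par_neq pos _.
have [K [K0 KE cK uK]] := prim_lower wfI pos sz Fe.
have kE' : (ntrees S)%:R = n'.+1%:R - #|K|%:R :> R.
  by rewrite -kE -[in X in X%:R - _]KE natrD addrAC subrr add0r.
have load := feasible_load wfI feas.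
have := kept_optimal wfI pn K0; rewrite -/F /cost kE' => opt.
apply: le_trans (opt _) _; last by rewrite lerD2r.
by rewrite -kE'; apply: le_trans load; rewrite lerD2r.
Qed.

(** * Cutting paths into segments *)

Lemma ler_sum_seq (R : realType) (T : finType) (A : {set T}) (l : seq T) (f : T -> R) :
  {subset A <= l} -> {in l, forall e, 0 <= f e} ->
  \sum_(e in A) f e <= \sum_(e <- l) f e.
Proof.
elim: l A => [|a l IH] A sub f0.
  rewrite big_nil big1 // => e eA; by have := sub _ eA.
rewrite big_cons; have f0' : {in l, forall e, 0 <= f e}.
  by move=> e el; apply: f0; rewrite inE el orbT.
have fa : 0 <= f a by apply: f0; rewrite inE eqxx.
have [aA|aA] := boolP (a \in A).
  rewrite (big_setD1 a aA) lerD2l; apply: IH => // e /setD1P[ea /sub].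
  by rewrite inE (negbTE ea).
apply: (@le_trans _ _ (\sum_(e <- l) f e)); last by lra.
apply: IH => // e eA; have := sub _ eA; rewrite inE => /predU1P[E|//].
by rewrite -E eA in aA.
Qed.

Section Links.
Variable T : eqType.

Fixpoint links (x : T) (t : seq T) : seq (T * T) :=
  if t is y :: t' then (x, y) :: links y t' else [::].

Lemma links_rcons x t y : links x (rcons t y) = rcons (links x t) (last x t, y).
Proof. by elim: t x => //= z t IH x; rewrite IH. Qed.

Lemma links_split x t e : e \in links x t ->
  exists a b, x :: t = a ++ e.1 :: e.2 :: b.
Proof.
elim: t x => //= y t IH x; rewrite inE => /predU1P[->|/IH[a [b ->]]].
  by exists [::], t.
by exists (x :: a), b.
Qed.

Lemma links_mem x t e : e \in links x t -> e.1 \in x :: t /\ e.2 \in x :: t.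
Proof.
by case/links_split=> a [b ->]; rewrite !mem_cat !inE !eqxx !orbT.
Qed.

(** A segment is a pair of head and tail, hence nonempty by construction. *)
Definition seg_verts (sg : T * seq T) := sg.1 :: sg.2.
Definition seg_links (sg : T * seq T) := links sg.1 sg.2.
Definition verts (ss : seq (T * seq T)) := flatten (map seg_verts ss).
Definition all_links (ss : seq (T * seq T)) := flatten (map seg_links ss).

Lemma verts_cons sg ss : verts (sg :: ss) = seg_verts sg ++ verts ss.
Proof. by []. Qed.

Lemma mem_verts ss sg x : sg \in ss -> x \in seg_verts sg -> x \in verts ss.
Proof. by move=> sgs xsg; apply/flattenP; exists (seg_verts sg); rewrite ?map_f. Qed.

Lemma vertsP ss x : x \in verts ss -> exists2 sg, sg \in ss & x \in seg_verts sg.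
Proof. by case/flattenP=> _ /mapP[sg sgs ->] xsg; exists sg. Qed.

Lemma all_linksP ss e : e \in all_links ss -> exists2 sg, sg \in ss & e \in seg_links sg.
Proof. by case/flattenP=> _ /mapP[sg sgs ->] xsg; exists sg. Qed.

Lemma seg_inj ss sg sg' x : uniq (verts ss) -> sg \in ss -> sg' \in ss ->
  x \in seg_verts sg -> x \in seg_verts sg' -> sg = sg'.
Proof.
elim: ss => // s ss IH; rewrite verts_cons cat_uniq.
case/and3P=> _ /hasPn disj un; rewrite !inE.
have dis s' : s' \in ss -> x \in seg_verts s' -> x \in seg_verts s -> False.
  by move=> s's xs' xs; have := disj x (mem_verts s's xs'); rewrite xs.
move=> /predU1P[->|s1] /predU1P[->|s2] // x1 x2; last exact: IH.
  by case: (dis _ s2 x2).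
by case: (dis _ s1 x1).
Qed.

(** Positions in the concatenated list act as a height function that rises by one along every
    link. *)
Lemma link_index ss e : uniq (verts ss) -> e \in all_links ss ->
  index e.2 (verts ss) = (index e.1 (verts ss)).+1 /\ e.2 \in verts ss.
Proof.
move=> un /all_linksP[sg sgs /links_split[a [b Esg]]]; rewrite -/(seg_verts sg) in Esg.
have [A [B E]] : exists A B, verts ss = A ++ e.1 :: e.2 :: B.
  case/splitPr: sgs => s1 s2; rewrite /verts map_cat flatten_cat -!/(verts _).
  by exists (verts s1 ++ a), (b ++ verts s2); rewrite verts_cons Esg -!catA.
rewrite E in un *; move: un; rewrite cat_uniq /= inE !negb_or.
case/and5P=> _ /and3P[/negbTE n1 /negbTE n2 _] /andP[/negbTE ne _] _ _.
by rewrite !index_cat n1 n2 /= ne !eqxx addn0 addn1 mem_cat !inE eqxx !orbT.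
Qed.

End Links.

(** * Disjoint segments as a feasible solution *)

Section Segments.
Variables (R : realType) (n : nat) (I : instance R n).
Hypothesis wfI : wf_instance I.

Definition link_edges (l : seq ('I_n * 'I_n)) := [seq [set e.1; e.2] | e <- l].

Definition seg_load (sg : 'I_n * seq 'I_n) :=
  \sum_(e <- seg_links sg) elod I e.1 e.2 + \sum_(v <- seg_verts sg) vload I v.

Variable ss : seq ('I_n * seq 'I_n).
Hypothesis un : uniq (verts ss).
Hypothesis full : forall v, v \in verts ss.

Let F := [set e | e \in link_edges (all_links ss)].

Lemma link_neq e : e \in all_links ss -> e.1 != e.2.
Proof.
move=> /(link_index un)[E _]; apply/eqP => eq; move: E; rewrite eq.
exact: n_Sn.
Qed.

Lemma adj_link x y : adj F x y ->
  exists2 e, e \in all_links ss & (x = e.1 /\ y = e.2) \/ (x = e.2 /\ y = e.1).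
Proof. by rewrite /adj inE => /mapP[e el /set2_inj h]; exists e. Qed.

(** Opposite orientations of one edge would need two positions that each exceed the other by one;
    links themselves differ in their second ends. *)
Lemma link_edges_uniq : uniq (link_edges (all_links ss)).
Proof.
rewrite map_inj_in_uniq; last first.
  move=> [x y] [x' y'] /(link_index un)[/= i1 _] /(link_index un)[/= i2 _].
  case/set2_inj=> [[-> ->]|[E1 E2]] //; subst.
  by exfalso; move: i1; rewrite i2 => /esym/eqP; rewrite -addn2 -{2}[index _ _]addn0 eqn_add2l.
apply: (map_uniq (f := fun e => e.2)).
suff -> : [seq e.2 | e <- all_links ss] = flatten [seq sg.2 | sg <- ss].
  move: un; elim: (ss) => // sg s IH; rewrite verts_cons cat_uniq.
  case/and3P=> u1 /hasPn d /IH us; have usg : uniq sg.2 by case/andP: u1.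
  rewrite /= cat_uniq usg us andbT /=.
  apply/hasPn => x /flattenP[_ /mapP[s' s's ->] xs'].
  have := d x; rewrite (mem_verts s's) ?inE ?xs' ?orbT // => /(_ isT).
  by rewrite /= negb_or => /andP[].
rewrite /all_links; elim: (ss) => //= sg s IH; rewrite map_cat IH; congr (_ ++ _).
by case: sg => x t; rewrite /seg_links /=; elim: t x => //= y t IHt x; rewrite IHt.
Qed.

(** Both cycle neighbours of the vertex at the highest position would sit just below it and so
    coincide. *)
Lemma segs_acyclic : acyclic F.
Proof.
move=> s sz us; apply/negP => cyc.
pose idx v := index v (verts ss).
have idx_inj x y : idx x = idx y -> x = y.
  by move=> E; rewrite -(nth_index x (full x)) -/(idx x) E nth_index.
have adj_idx x y : adj F x y -> idx x = (idx y).+1 \/ idx y = (idx x).+1.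
  by case/adj_link=> e /(link_index un)[E _] [[-> ->]|[-> ->]]; [right|left].
have [x0 x0s] : exists x, x \in s by case: (s) sz => // x ? _; exists x; rewrite mem_head.
case: (arg_maxnP idx x0s) => x xs max.
have below y : y \in s -> adj F x y -> idx x = (idx y).+1.
  by move=> /max le /adj_idx[//|E]; move: le; rewrite /= E ltnn.
have [i s' Es] := rot_to xs.
move: cyc us sz; rewrite -(rot_cycle i) -(rot_uniq i) -(size_rot i) Es.
have sub y : y \in s' -> y \in s by move=> h; rewrite -(mem_rot i) Es inE h orbT.
case: s' sub {Es} => [|y [|z s']] sub //= /andP[xy].
rewrite rcons_path => /and3P[_ _]; rewrite adj_sym => zx /and3P[_ yz _] _.
move: (mem_last z s') yz zx; set w := last _ _ => wz yz zx.
have E1 := below y (sub _ (mem_head _ _)) xy.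
have ws : w \in s by apply: sub; rewrite inE wz orbT.
have E2 := below w ws zx; have : y = w by apply: idx_inj; apply/succn_inj; rewrite -E1.
by move=> E; rewrite E wz in yz.
Qed.

(** No edge leaves a segment since segments are disjoint; conversely the links join every vertex to
    the head. *)
Lemma seg_connect sg x : sg \in ss -> x \in seg_verts sg ->
  pblock (trees F) x = [set y in seg_verts sg].
Proof.
move=> sgs xsg; apply/setP => y; rewrite mem_tree inE; apply/idP/idP.
  case/connectP=> p; elim: p x xsg => /= [x xsg _ ->//|z p IH x xsg /andP[xz pz]].
  apply: IH pz; have [e el h] := adj_link xz.
  have [sg' sgs' /links_mem[e1 e2]] := all_linksP el.
  have : x \in seg_verts sg' by case: h => [[-> _]|[-> _]].
  move=> /(seg_inj un sgs sgs' xsg) ->; by case: h => [[_ ->]|[_ ->]].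
have conn z : z \in seg_verts sg -> connect (adj F) sg.1 z.
  apply: (@path_connect _ (adj F)).
  have sub e : e \in links sg.1 sg.2 -> adj F e.1 e.2.
    move=> el; rewrite /adj inE; apply/mapP; exists e => //.
    by apply/flattenP; exists (seg_links sg); rewrite ?map_f.
  elim: sg.2 sg.1 sub => //= w t IH h sub; rewrite IH ?andbT.
    by have := sub (h, w); apply; rewrite inE eqxx.
  by move=> e el; apply: sub; rewrite inE el orbT.
by move=> ysg; apply: connect_trans (conn y ysg); rewrite connect_adj_sym conn.
Qed.

Lemma segs_feasible : (forall sg, sg \in ss -> seg_load sg <= 1) ->
  feasible I (Solution (size ss) F).
Proof.
move=> le1.
have mem_trees : trees F =i [seq [set y in seg_verts sg] | sg <- ss].
  move=> A; apply/idP/mapP => [AF|[sg sgs ->]]; last first.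
    rewrite -(seg_connect sgs (mem_head _ _)); exact: pblock_trees.
  have /and3P[_ tI n0] := trees_partition F.
  have [E|[x xA]] := set_0Vmem A; first by move: n0; rewrite -E AF.
  have [sg sgs xsg] := vertsP (full x).
  by exists sg => //; rewrite -(seg_connect sgs xsg) (def_pblock tI AF xA).
split => /=.
- have : (0 < n)%N by case: wfI.
  case: (n) ss full => // k s f _; have [sg] := vertsP (f ord0).
  by case: s {f}.
- apply/subsetP => e; rewrite inE => /mapP[p /link_neq pe ->]; exact: pair_edge.
- exact: segs_acyclic.
- rewrite (eq_card mem_trees) -(size_map (fun sg => [set y in seg_verts sg])).
  apply/card_uniqP; move: un; elim: (ss) => // sg s IH.
  rewrite verts_cons cat_uniq => /and3P[_ /hasPn d /IH us]; rewrite /= us andbT.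
  apply/mapP => -[sg' sgs' /setP/(_ sg.1)]; rewrite !inE eqxx /= => /esym h.
  by have := d sg.1 (mem_verts sgs' h); rewrite /= inE eqxx.
- move=> A; rewrite mem_trees => /mapP[sg sgs ->].
  apply: le_trans (le1 _ sgs); rewrite /tree_load /seg_load; apply: lerD.
    rewrite -big_set /= -(big_map (fun e => [set e.1; e.2]) xpredT (eload I)).
    apply: ler_sum_seq => e; last first.
      case/mapP=> p psg ->; apply/(eload_ge0 wfI)/pair_edge/link_neq.
      by apply/flattenP; exists (seg_links sg); rewrite ?map_f.
    rewrite !inE => /andP[/mapP[p /all_linksP[sg' sgs' psg'] ->] sub].
    apply: map_f; have [p1 _] := links_mem psg'.
    suff -> : sg = sg' by [].
    apply: (seg_inj un sgs sgs' _ p1).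
    by have := subsetP sub p.1 (set21 _ _); rewrite inE.
  apply: ler_sum_seq => v; first by rewrite inE.
  by move=> _; case: wfI => _ _ /(_ v)/andP[].
Qed.

Lemma segs_cost : cost I (Solution (size ss) F)
  <= \sum_(e <- all_links ss) ecst I e.1 e.2 + opening I * (size ss)%:R.
Proof.
rewrite /cost lerD2r /= -(big_map (fun e => [set e.1; e.2]) xpredT (ecost I)).
apply: ler_sum_seq => e; first by rewrite inE.
by case/mapP=> p /link_neq pe ->; apply/(ecost_ge0 wfI)/pair_edge.
Qed.

End Segments.

(** * Laying trees out as paths, and the amortised greedy cut *)

Section Layout.
Variables (R : realType) (n' : nat).
Local Notation n := n'.+1.
Variable I : instance R n.
Variable par : 'I_n -> 'I_n.
Hypothesis wfI : wf_instance I.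

Let kp := kept I par.

Fixpoint insert_after (p v : 'I_n) (ws : seq 'I_n) : seq 'I_n :=
  if ws is x :: ws' then
    x :: (if x == p then v :: ws' else insert_after p v ws')
  else [::].

(** Since [os] lists the newest vertex first, the recursion places a parent before its child. A
    vertex that is not kept opens a new path at the front, so each path is one such vertex followed
    by a run of kept ones. *)
Fixpoint layout (os : seq 'I_n) : seq 'I_n :=
  if os is v :: os' then
    if kp v then insert_after (par v) v (layout os') else v :: layout os'
  else [::].

Lemma kept_root : kp ord0 = false.
Proof. by rewrite /kp /kept eqxx. Qed.

Lemma insert_after_cat p v a b : p \notin a ->
  insert_after p v (a ++ p :: b) = a ++ p :: v :: b.
Proof.
elim: a => /= [_|x a IH]; first by rewrite eqxx.
by rewrite inE negb_or eq_sym => /andP[/negbTE-> /IH->].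
Qed.

Lemma perm_insert_after p v ws : p \in ws ->
  perm_eq (insert_after p v ws) (v :: ws).
Proof.
elim: ws => //= x ws IH; rewrite inE (eq_sym p); case: eqP => [_ _|_ /= /IH h].
  exact: permEl (perm_catCA [:: x] [:: v] ws).
apply: perm_trans (permEl (perm_catCA [:: x] [:: v] ws)).
by rewrite /= perm_cons.
Qed.

Lemma perm_layout os : prim I par os -> perm_eq (layout os) os.
Proof.
elim=> [|{}os v _ IH vos pvos _] //=.
case: ifP => _; last by rewrite perm_cons.
apply: perm_trans (perm_insert_after _ _) _; last by rewrite perm_cons.
by rewrite (perm_mem IH).
Qed.

(** A link into a vertex that is not kept passes between two paths and is not counted. *)
Definition kept_len (d : 'I_n -> 'I_n -> R) x t :=
  \sum_(e <- links x t | kp e.2) d e.1 e.2.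

Lemma kept_len_cons d x y t :
  kept_len d x (y :: t) = (if kp y then d x y else 0) + kept_len d y t.
Proof. by rewrite /kept_len /= big_cons /=; case: ifP => // _; rewrite add0r. Qed.

(** Ensures that a path opened in front of the list adds no counted link. *)
Lemma layout_cons os : prim I par os ->
  exists h t, layout os = h :: t /\ ~~ kp h.
Proof.
elim=> [|{}os v _ [h [t [E hk]]] _ _ _] /=; first by exists ord0, [::]; rewrite kept_root.
case: ifPn => vk; last by exists v, (layout os).
by rewrite E /=; eexists; eexists; split; first reflexivity.
Qed.

Section Metric.
Variable d : 'I_n -> 'I_n -> R.
Hypothesis d_ge0 : forall x y, x != y -> 0 <= d x y.
Hypothesis d_sym : forall x y, d x y = d y x.
Hypothesis d_tri : forall x y z, x != y -> y != z -> x != z -> d x z <= d x y + d y z.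

(** If [y] followed [p], the triangle inequality d v y <= d v p + d p y bounds the detour by 2 d p
    v; if [p] was last or [y] opens a path, d p v alone is added. *)
Lemma insert_after_len p v x t t' : uniq (x :: t) -> p \in x :: t -> v \notin x :: t ->
  kp v -> insert_after p v (x :: t) = x :: t' ->
  kept_len d x t' <= kept_len d x t + 2 * d p v.
Proof.
elim: t x t' => [|y t IH] x t' un pin vin kv /= [<-].
  move: pin vin; rewrite !inE => /eqP-> vx; rewrite eqxx kept_len_cons kv.
  have := d_ge0 (x := x) (y := v); rewrite eq_sym vx => /(_ isT).
  by rewrite /kept_len /= big_nil; lra.
move: un pin vin => /andP[xyt unyt]; rewrite in_cons.
rewrite eq_sym !in_cons !negb_or => + /and3P[vx vy vt].
have xy : x != y by move: xyt; rewrite in_cons negb_or => /andP[].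
have [<- _|xp /= pin] := eqVneq x p.
  rewrite !kept_len_cons kv.
  have h1 := d_ge0 vx; have h2 := d_ge0 vy; rewrite eq_sym in vx.
  have h3 := d_tri (x := v) (y := x) (z := y); rewrite (eq_sym v x) vx xy vy in h3.
  by have := h3 isT isT isT; rewrite (d_sym v x) in h1 *; case: ifP; lra.
rewrite -/(insert_after p v (y :: t)).
have vyt : v \notin y :: t by rewrite in_cons negb_or vy.
have [t2 E2] : exists t2, insert_after p v (y :: t) = y :: t2 by eexists.
rewrite E2 !kept_len_cons.
by have := IH _ _ unyt pin vyt kv E2; lra.
Qed.

Lemma layout_len os h t : prim I par os -> layout os = h :: t ->
  kept_len d h t <= 2 * \sum_(v <- os | kp v) d (par v) v.
Proof.
move=> pos; elim: pos h t => [|{}os v pos IH vos pvos _] h t /=.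
  move=> -[<- <-]; by rewrite big_cons kept_root big_nil /kept_len /= big_nil mulr0.
rewrite big_cons; have [h' [t' [E h'k]]] := layout_cons pos.
have le := IH _ _ E; have pl := perm_layout pos; rewrite E in pl.
have [vk|vk] := boolP (kp v); rewrite E.
  move=> Ei; have Eh : h' = h by case: Ei.
  rewrite Eh in Ei le pl.
  have := insert_after_len _ _ _ vk Ei.
  rewrite (perm_uniq pl) !(perm_mem pl) (prim_uniq pos) => /(_ isT pvos vos); lra.
case=> <- <-; rewrite kept_len_cons (negbTE h'k) add0r.
exact: le.
Qed.

End Metric.

(* Potential of the greedy cut: a cut at an overflowing kept link is paid for by
   that link, the load of the closed segment and one copy of the new vertex. *)
Definition charge x rest := kept_len (elod I) x rest +
  \sum_(v <- rest) (2 * vload I v + (~~ kp v)%:R).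

(** Loop invariant of the cut: [ss] is closed, [(h, t)] is open with load [L], [rest] is unread. In
    the fourth clause [L] is potential saved towards the next cut. *)
Definition scanned (ws : seq 'I_n) ss (h : 'I_n) t rest (L : R) :=
  let sg := rcons ss (h, t) in
  [/\ verts sg ++ rest = ws,
      forall s, s \in sg -> seg_load I s <= 1,
      L = seg_load I (h, t) /\ 0 <= L,
      (size sg)%:R + L + charge (last h t) rest
        <= kept_len (elod I) (head ord0 ws) (behead ws)
           + \sum_(v <- ws) (2 * vload I v + (~~ kp v)%:R)
    & \sum_(e <- all_links sg) ecst I e.1 e.2 + kept_len (ecst I) (last h t) rest
        <= kept_len (ecst I) (head ord0 ws) (behead ws)].

Lemma seg_load1 h : seg_load I (h, [::]) = vload I h.
Proof. by rewrite /seg_load /seg_links /seg_verts /= big_nil big_cons big_nil addr0 add0r. Qed.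

Lemma vload_ge0 v : 0 <= vload I v.
Proof. by case: wfI => _ _ /(_ v)/andP[]. Qed.

Lemma vload_le1 v : vload I v <= 1.
Proof. by case: wfI => _ _ /(_ v)/andP[_ /ltW]. Qed.

Lemma scanned_init h rest : ~~ kp h ->
  scanned (h :: rest) [::] h [::] rest (vload I h).
Proof.
move=> hk; have b0 := vload_ge0 h; split => //=.
- by move=> s; rewrite inE => /eqP->; rewrite seg_load1 vload_le1.
- by rewrite seg_load1.
- by rewrite big_cons hk /charge (_ : true%:R = 1 :> R) //; lra.
- by rewrite /all_links /= big_nil add0r.
Qed.

Lemma scanned_extend ws ss h t x rest L : last h t != x -> kp x ->
  L + elod I (last h t) x + vload I x <= 1 ->
  scanned ws ss h t (x :: rest) L ->
  scanned ws ss h (rcons t x) rest (L + elod I (last h t) x + vload I x).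
Proof.
move=> ne xk fits [Ews le1 [EL L0] size_le cost_le].
have u0 : 0 <= elod I (last h t) x by exact/(eload_ge0 wfI)/pair_edge.
have b0 := vload_ge0 x.
have EL' : L + elod I (last h t) x + vload I x = seg_load I (h, rcons t x).
  rewrite EL /seg_load /seg_links /seg_verts /= links_rcons -rcons_cons.
  by rewrite !big_rcons /=; lra.
split; rewrite ?last_rcons.
- rewrite -Ews /verts !map_rcons !flatten_rcons /seg_verts /= -!catA /=.
  by rewrite -cats1 -catA.
- move=> s; rewrite mem_rcons inE => /predU1P[->|sss]; first by rewrite -EL'.
  by apply: le1; rewrite mem_rcons inE sss orbT.
- by split=> //; lra.
- apply: le_trans size_le; rewrite !size_rcons /charge kept_len_cons xk big_cons xk.
  by rewrite /=; lra.
- apply: le_trans cost_le; rewrite kept_len_cons xk /all_links !map_rcons !flatten_rcons.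
  by rewrite !big_cat /seg_links /= links_rcons big_rcons /=; lra.
Qed.

(** If [x] is not kept, its unit in [charge] pays for the new segment; otherwise the overflow L + u
    + b(x) > 1 pays. The other copy of b(x) becomes the new [L]. *)
Lemma scanned_cut ws ss h t x rest L : last h t != x ->
  ~~ (kp x && (L + elod I (last h t) x + vload I x <= 1)) ->
  scanned ws ss h t (x :: rest) L ->
  scanned ws (rcons ss (h, t)) x [::] rest (vload I x).
Proof.
move=> ne cut [Ews le1 [EL L0] size_le cost_le].
have u0 : 0 <= elod I (last h t) x by exact/(eload_ge0 wfI)/pair_edge.
have c0 : 0 <= ecst I (last h t) x by exact/(ecost_ge0 wfI)/pair_edge.
have b0 := vload_ge0 x.
split.
- rewrite -Ews [in LHS]/verts map_rcons flatten_rcons -catA.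
  by [].
- move=> s; rewrite mem_rcons inE => /predU1P[->|/le1//].
  by rewrite seg_load1 vload_le1.
- by rewrite seg_load1.
- apply: le_trans size_le; rewrite !size_rcons /charge kept_len_cons big_cons /=.
  have -> : (size ss).+2%:R = (size ss).+1%:R + 1 :> R by rewrite natr1.
  by move: cut; case: (kp x) => /=; [rewrite -ltNge | ]; lra.
- apply: le_trans cost_le; rewrite kept_len_cons /all_links map_rcons flatten_rcons.
  by rewrite big_cat /seg_links /= big_nil; case: (kp x); lra.
Qed.

Lemma scanned_approx os ss h t L (sg := rcons ss (h, t))
    (S := Solution (size sg) [set e | e \in link_edges (all_links sg)]) :
  prim I par os -> size os = n -> scanned (layout os) ss h t [::] L ->
  [/\ uniq (link_edges (all_links sg)), feasible I S &
    forall Sopt, feasible I Sopt -> cost I S <= 3 * cost I Sopt].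
Proof.
move=> pos sz [Ews le1 [EL L0] size_le cost_le]; rewrite cats0 -/sg in Ews le1.
have pl := perm_layout pos.
have un : uniq (verts sg) by rewrite Ews (perm_uniq pl) (prim_uniq pos).
have pe : perm_eq os (enum 'I_n).
  apply: uniq_perm; rewrite ?enum_uniq ?(prim_uniq pos) // => v.
  by rewrite mem_enum (prim_full pos sz).
have full v : v \in verts sg by rewrite Ews (perm_mem pl) (perm_mem pe) mem_enum.
split; [exact: link_edges_uniq | exact: segs_feasible | ].
move=> Sopt feas.
have pn v : v != ord0 -> par v != v.
  by apply: prim_par_neq pos _; rewrite (perm_mem pe) mem_enum.
apply: le_trans (segs_cost wfI un) _.
have low := kept_lower wfI pos sz feas.
have cap := kept_capacity wfI pn.
set F := [set v | kept I par v] in low cap.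
have sumF (f : 'I_n -> R) : \sum_(v <- os | kp v) f v = \sum_(v in F) f v.
  rewrite (perm_big _ pe) /= big_enum_cond /=.
  by apply: eq_bigl => v; rewrite inE.
have [h0 [t0 [El h0k]]] := layout_cons pos.
have [_ [mc mu] _ _ g0] := wfI.
have lenc := @layout_len (ecst I) _ _ _ _ h0 t0 pos El.
have lenu := @layout_len (elod I) _ _ _ _ h0 t0 pos El.
have {}lenc : kept_len (ecst I) h0 t0 <= 2 * \sum_(v in F) ecst I (par v) v.
  rewrite -sumF; apply: lenc => [x y /pair_edge|x y|x y z].
  - exact: ecost_ge0.
  - by rewrite /ecst setUC.
  - by move=> xy yz xz; case: mc => _; apply.
have {}lenu : kept_len (elod I) h0 t0 <= 2 * \sum_(v in F) elod I (par v) v.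
  rewrite -sumF; apply: lenu => [x y /pair_edge|x y|x y z].
  - exact: eload_ge0.
  - by rewrite /elod setUC.
  - by move=> xy yz xz; case: mu => _; apply.
move: size_le cost_le; rewrite El /= -El -/sg /charge big_nil.
rewrite {1 3}/kept_len !big_nil (perm_big _ pl) (perm_big _ pe) /= big_enum /=.
rewrite big_split /= -mulr_sumr.
(* The number of paths before cutting. *)
have -> : \sum_v (~~ kp v)%:R = n%:R - #|F|%:R :> R.
  suff <- : \sum_v (~~ kp v)%:R + #|F|%:R = n%:R :> R by rewrite addrK.
  rewrite -sum1_card natr_sum (big_mkcond [in F]) -big_split /=.
  rewrite (eq_bigr (fun=> 1)) => [|v _]; first by rewrite sumr_const card_ord.
  by rewrite inE -/(kp v); case: (kp v); rewrite ?add0r ?addr0.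
move=> size_le cost_le.
have : opening I * (size sg)%:R <= opening I * (3 * (n%:R - #|F|%:R)).
  by apply: ler_wpM2l => //; lra.
(* Allows 2 c(F) to be enlarged to 3 c(F), matching the factor on openings. *)
have : 0 <= \sum_(v in F) ecst I (par v) v.
  by apply: sumr_ge0 => v; rewrite inE => /kept_neq0; exact: par_cost_ge0.
by rewrite (mulrCA _ 3); lra.
Qed.

End Layout.

(** * Total correctness and running time *)

Section Programs.
Local Open Scope nat_scope.
Variable R : realType.
Implicit Type s : state R.

Fixpoint straight (c : cmd) : bool :=
  match c with
  | Seq c1 c2 | If _ c1 c2 => straight c1 && straight c2
  | While _ _ => false
  | _ => true
  end.

(** Lets loop-free bodies be verified by mere simplification; the value at [While] is a dummy,
    excluded by [straight]. *)
Fixpoint sem (c : cmd) s : state R :=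
  match c with
  | NSet x e => set_nreg s x (neval s e)
  | RSet x e => set_rreg s x (reval s e)
  | NPut a i e => set_narr s a (neval s i) (neval s e)
  | RPut a i e => set_rarr s a (neval s i) (reval s e)
  | Seq c1 c2 => sem c2 (sem c1 s)
  | If b c1 c2 => if beval s b then sem c1 s else sem c2 s
  | _ => s
  end.

(* Worst-case running time when every loop makes at most [n] iterations. *)
Fixpoint time_bound (n : nat) (c : cmd) : nat :=
  match c with
  | Skip => 1
  | NSet _ e => (ntime e).+1
  | RSet _ e => (rtime e).+1
  | NPut _ i e => (ntime i + ntime e).+1
  | RPut _ i e => (ntime i + rtime e).+1
  | Seq c1 c2 => (time_bound n c1 + time_bound n c2).+1
  | If b c1 c2 => (btime b + (time_bound n c1 + time_bound n c2)).+1
  | While b c1 => n * (btime b + time_bound n c1).+1 + (btime b).+1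
  end.

(** A total-correctness triple that carries the syntactic time bound, so correctness proofs yield
    the running time as well. *)
Definition runs (n : nat) (c : cmd) s (Q : state R -> Prop) :=
  exists t s', [/\ exec c s t s', t <= time_bound n c & Q s'].

Lemma runs_straight n c s (Q : state R -> Prop) :
  straight c -> Q (sem c s) -> runs n c s Q.
Proof.
move=> str Qs; suff [t ex le] : exists2 t, exec c s t (sem c s) & t <= time_bound n c.
  by exists t, (sem c s).
elim: c s str {Qs Q} => //=.
- by move=> s _; exists 1; first exact: ExecSkip.
- by move=> x e s _; eexists; first exact: ExecNSet.
- by move=> x e s _; eexists; first exact: ExecRSet.
- by move=> a i e s _; eexists; first exact: ExecNPut.
- by move=> a i e s _; eexists; first exact: ExecRPut.
- move=> c1 IH1 c2 IH2 s /andP[/(IH1 s)[t1 e1 l1] /(IH2 (sem c1 s))[t2 e2 l2]].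
  by eexists; [exact: ExecSeq e1 e2 | rewrite ltnS leq_add].
- move=> b c1 IH1 c2 IH2 s /andP[/(IH1 s)[t1 e1 l1] /(IH2 s)[t2 e2 l2]].
  case: ifPn => hb.
    eexists; first exact: ExecIfTrue hb e1.
    by rewrite ltnS leq_add2l (leq_trans l1) ?leq_addr.
  eexists; first exact: ExecIfFalse hb e2.
  by rewrite ltnS leq_add2l (leq_trans l2) ?leq_addl.
Qed.

Lemma runs_seq n c1 c2 s Q :
  runs n c1 s (fun s1 => runs n c2 s1 Q) -> runs n (Seq c1 c2) s Q.
Proof.
case=> t1 [s1 [e1 l1 [t2 [s2 [e2 l2 Qs]]]]].
by exists (t1 + t2).+1, s2; split=> //; [exact: ExecSeq e1 e2 | rewrite /= ltnS leq_add].
Qed.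

Lemma runs_mono n c s (P Q : state R -> Prop) :
  (forall s', P s' -> Q s') -> runs n c s P -> runs n c s Q.
Proof. by move=> PQ [t [s' [e l /PQ Qs]]]; exists t, s'. Qed.

Lemma runs_while n b c (P : nat -> state R -> Prop) lo s : lo <= n -> P lo s ->
  (forall i s, i < n -> P i s -> beval s b /\ runs n c s (P i.+1)) ->
  (forall s, P n s -> ~~ beval s b) ->
  runs n (While b c) s (P n).
Proof.
move=> lon Ps step stop.
suff [t [s' [ex le Ps']]] : exists t s', [/\ exec (While b c) s t s',
    t <= (n - lo) * (btime b + time_bound n c).+1 + (btime b).+1 & P n s'].
  exists t, s'; split=> //; apply: leq_trans le _.
  by rewrite /= leq_add2r leq_mul2r leq_subr orbT.
move: {2}(n - lo) (erefl (n - lo)) => k; elim: k lo s lon Ps => [|k IH] lo s lon Ps E.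
  have En : lo = n by apply/eqP; rewrite eqn_leq lon -subn_eq0 E.
  subst lo; exists (btime b).+1, s; rewrite E mul0n add0n; split => //.
  exact/ExecWhileFalse/stop.
have lt : lo < n by rewrite -subn_gt0 E.
have [hb [t1 [s1 [e1 l1 P1]]]] := step lo s lt Ps.
have [|t2 [s2 [e2 l2 P2]]] := IH lo.+1 s1 lt P1; first by rewrite subnS E.
exists (btime b + t1 + t2).+1, s2; split=> //; first exact: ExecWhileTrue hb e1 e2.
rewrite E mulSn addSn addSn ltnS -[leqRHS]addnA leq_add ?leq_add2l //.
by move: l2; rewrite subnS E.
Qed.

(** The upper limit is always register 0, so loop invariants must preserve its value n. *)
Definition For (x lo : nat) (c : cmd) : cmd :=
  Seq (NSet x (NLit lo))
    (While (BNLe (NAdd (NReg x) (NLit 1)) (NReg 0))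
      (Seq c (NSet x (NAdd (NReg x) (NLit 1))))).

Lemma runs_for n x lo c (P : nat -> state R -> Prop) s : lo <= n ->
  P lo (set_nreg s x lo) ->
  (forall i s, P i s -> nreg s x = i /\ nreg s 0 = n) ->
  (forall i s, lo <= i -> i < n -> P i s ->
     runs n c s (fun s' => nreg s' x = i /\ P i.+1 (set_nreg s' x i.+1))) ->
  runs n (For x lo c) s (P n).
Proof.
move=> lon Ps reg step; apply: runs_seq; apply: runs_straight => //.
apply: runs_mono (@runs_while n _ _ (fun i s => lo <= i /\ P i s) lo _ _ _ _ _) => //.
- by move=> s' [].
- move=> i s' lt [loi Pi]; have [/= -> ->] := reg _ _ Pi; rewrite addn1; split=> //.
  apply: runs_seq; apply: runs_mono (step _ _ loi lt Pi) => s1 [E P1].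
  by apply: runs_straight; rewrite //= E addn1; split=> //; exact: leqW.
- by move=> s' [_ Pn]; have [/= -> ->] := reg _ _ Pn; rewrite addn1 ltnn.
Qed.

End Programs.

(** * The program *)

(* Natural registers: 0 the order n (at the end the number of trees), 1 number
   of output edges, 2 and 3 loop counters, 4 current vertex, 5 head of the linked
   list, 6 number of trees, 7 next vertex, 8 row offset.
   Natural arrays: 0 and 1 output edges, 2 row offsets x * n, 3 Prim parent,
   4 visited flag, 5 Prim order, 6 flag of the vertices that are not kept,
   7 successor in the linked list.
   Real registers: 0 opening cost, 1 sum of b(v) - 1, 2 accumulator, 3 load of
   the current segment. *)
Definition Ecst (x y : nexp) := RGet 1 (NAdd (NGet 2 x) y).
Definition Elod (x y : nexp) := RGet 2 (NAdd (NGet 2 x) y).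
Definition Ekey (x y : nexp) := RAdd (Ecst x y) (Elod x y).
Definition Epkey (x : nexp) := Ekey (NGet 3 x) x.
Definition Incr (x : nat) := NSet x (NAdd (NReg x) (NLit 1)).
Definition Iszero (e : nexp) := BNLe e (NLit 0).

(** Naturals have no multiplication, so row offsets x * n are built by repeated addition and
    tabulated. *)
Definition init_body : cmd :=
  Seq (NPut 2 (NReg 2) (NReg 8))
  (Seq (NSet 8 (NAdd (NReg 8) (NReg 0)))
  (Seq (NPut 3 (NReg 2) (NLit 0))
  (Seq (NPut 4 (NReg 2) (NLit 0))
       (RSet 1 (RAdd (RReg 1) (RSub (RGet 0 (NReg 2)) ROne)))))).

Definition init_prog : cmd :=
  Seq (NSet 8 (NLit 0)) (Seq (RSet 1 RZero)
  (Seq (For 2 0 init_body)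
       (Seq (NPut 4 (NLit 0) (NLit 1)) (NPut 5 (NLit 0) (NLit 0))))).

(** The search starts at vertex 0, which is always visited: a visited candidate means that none was
    found yet. *)
Definition select_body : cmd :=
  If (Iszero (NGet 4 (NReg 3)))
    (If (Iszero (NGet 4 (NReg 4)))
       (If (BRLe (Epkey (NReg 3)) (Epkey (NReg 4))) (NSet 4 (NReg 3)) Skip)
       (NSet 4 (NReg 3)))
    Skip.

Definition relax_body : cmd :=
  If (BAnd (Iszero (NGet 4 (NReg 3)))
           (BRLe (Ekey (NReg 4) (NReg 3)) (Epkey (NReg 3))))
    (NPut 3 (NReg 3) (NReg 4)) Skip.

Definition prim_body : cmd :=
  Seq (NSet 4 (NLit 0))
  (Seq (For 3 0 select_body)
  (Seq (Seq (NPut 4 (NReg 4) (NLit 1)) (NPut 5 (NReg 2) (NReg 4)))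
       (For 3 0 relax_body))).

Definition prefix_body : cmd :=
  If (BNot (BAnd (BRLe (Epkey (NReg 2)) (Epkey (NReg 3)))
       (BNot (BAnd (BRLe (Epkey (NReg 3)) (Epkey (NReg 2))) (BNLe (NReg 3) (NReg 2))))))
    (RSet 2 (RAdd (RReg 2) (RAdd ROne (Elod (NGet 3 (NReg 3)) (NReg 3)))))
    Skip.

Definition keep_body : cmd :=
  Seq (RSet 2 (RReg 1))
  (Seq (For 3 1 prefix_body)
       (If (BAnd (BRLe (RReg 2) RZero)
                 (BRLe (Ecst (NGet 3 (NReg 2)) (NReg 2)) (RReg 0)))
          (NPut 6 (NReg 2) (NLit 0)) (NPut 6 (NReg 2) (NLit 1)))).

Definition keep_prog : cmd := Seq (NPut 6 (NLit 0) (NLit 1)) (For 2 1 keep_body).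

(** The successor of the last list element is never initialised; its arbitrary value may be copied
    but is never followed. *)
Definition layout_body : cmd :=
  Seq (NSet 4 (NGet 5 (NReg 2)))
      (If (Iszero (NGet 6 (NReg 4)))
         (Seq (NPut 7 (NReg 4) (NGet 7 (NGet 3 (NReg 4))))
              (NPut 7 (NGet 3 (NReg 4)) (NReg 4)))
         (Seq (NPut 7 (NReg 4) (NReg 5)) (NSet 5 (NReg 4)))).

Definition layout_prog : cmd := Seq (NSet 5 (NLit 0)) (For 2 1 layout_body).

Definition Eload : rexp :=
  RAdd (RAdd (RReg 3) (Elod (NReg 4) (NReg 7))) (RGet 0 (NReg 7)).

Definition scan_body : cmd :=
  Seq (NSet 7 (NGet 7 (NReg 4)))
  (Seq (If (BAnd (Iszero (NGet 6 (NReg 7))) (BRLe Eload ROne))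
          (Seq (NPut 0 (NReg 1) (NReg 4))
          (Seq (NPut 1 (NReg 1) (NReg 7))
          (Seq (Incr 1) (RSet 3 Eload))))
          (Seq (Incr 6) (RSet 3 (RGet 0 (NReg 7)))))
       (NSet 4 (NReg 7))).

(** Register 0 bounds the loop, so it receives the number of trees only at the end. *)
Definition scan_prog : cmd :=
  Seq (Seq (NSet 6 (NLit 1)) (Seq (NSet 1 (NLit 0))
      (Seq (NSet 4 (NReg 5)) (RSet 3 (RGet 0 (NReg 5))))))
  (Seq (For 2 1 scan_body) (NSet 0 (NReg 6))).

Definition approx_prog : cmd :=
  Seq init_prog (Seq (For 2 1 prim_body)
  (Seq keep_prog (Seq layout_prog scan_prog))).

(** * Verification of the program *)

Section Correctness.
Variables (R : realType) (n' : nat).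
Local Notation n := n'.+1.
Variable I : instance R n.
Hypothesis wfI : wf_instance I.
Implicit Type s : state R.

Definition loaded s :=
  input I s /\ forall x : 'I_n, narr s 2 x = (x * n)%N.

Lemma loaded_n s : loaded s -> nreg s 0 = n.
Proof. by case=> [[]]. Qed.

Lemma reval_vload s e (v : 'I_n) : loaded s -> neval s e = v ->
  reval s (RGet 0 e) = vload I v.
Proof. by move=> [[_ _ bE _ _] _] /= ->. Qed.

Lemma reval_cst s ex ey (x y : 'I_n) : loaded s -> neval s ex = x ->
  neval s ey = y -> x != y -> reval s (Ecst ex ey) = ecst I x y.
Proof. by move=> [[_ _ _ cE _] rowE] /= -> -> xy; rewrite rowE cE. Qed.

Lemma reval_lod s ex ey (x y : 'I_n) : loaded s -> neval s ex = x ->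
  neval s ey = y -> x != y -> reval s (Elod ex ey) = elod I x y.
Proof. by move=> [[_ _ _ _ uE] rowE] /= -> -> xy; rewrite rowE uE. Qed.

Lemma reval_key s ex ey (x y : 'I_n) : loaded s -> neval s ex = x ->
  neval s ey = y -> x != y -> reval s (Ekey ex ey) = key I x y.
Proof.
move=> ld xE yE xy; rewrite -[LHS]/(reval s (Ecst ex ey) + reval s (Elod ex ey)).
by rewrite (reval_cst ld xE yE xy) (reval_lod ld xE yE xy).
Qed.

Definition par_state s (par : 'I_n -> 'I_n) := forall x : 'I_n, narr s 3 x = par x.

Lemma reval_pkey s e (par : 'I_n -> 'I_n) (v : 'I_n) : loaded s -> par_state s par ->
  neval s e = v -> par v != v -> reval s (Epkey e) = pkey I par v.
Proof.
by move=> ld pE vE ne; apply: reval_key => //=; rewrite vE pE.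
Qed.

Definition vis_state s (os : seq 'I_n) := forall x : 'I_n, narr s 4 x = (x \in os).
Definition ord_state s (os : seq 'I_n) :=
  forall j, (j < size os)%N -> narr s 5 j = nth ord0 (rev os) j.

Definition attached (par : 'I_n -> 'I_n) (os : seq 'I_n) :=
  forall y, y \notin os -> par y \in os /\
    forall x, x \in os -> key I (par y) y <= key I x y.

(** Keeps the reads of tentative keys off the uninitialised diagonals. *)
Lemma attached_neq par os y : attached par os -> y \notin os -> par y != y.
Proof. by move=> at_ yos; have [pos _] := at_ y yos; apply: contraNneq yos => <-. Qed.

Definition tree_state s os par :=
  [/\ loaded s, rreg s 1 = slack I, par_state s par, vis_state s os
    & ord_state s os].

Definition grown os par := prim I par os /\ attached par os.

Lemma init_spec s : input I s ->
  runs n init_prog s (fun s' => tree_state s' [:: ord0] (fun=> ord0)).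
Proof.
move=> inp; do 2! (apply: runs_seq; apply: runs_straight => //=).
pose P i s := [/\ input I s, nreg s 2 = i, nreg s 8 = (i * n)%N,
  rreg s 1 = \sum_(v < n | (v < i)%N) (vload I v - 1)
  & forall x : 'I_n, (x < i)%N ->
    [/\ narr s 2 x = (x * n)%N, narr s 3 x = 0%N & narr s 4 x = 0%N]].
apply: runs_seq; apply: runs_mono (@runs_for _ n 2 0 init_body P _ _ _ _ _) => //.
- move=> s' [inp' _ _ slackE arrE]; apply: runs_straight => //=.
  split=> //.
  + by split=> // x; have [] := arrE x (ltn_ord x).
  + rewrite slackE; apply: eq_bigl => v; exact: ltn_ord.
  + by move=> x; have [] := arrE x (ltn_ord x).
  + move=> x; rewrite /= /upd /= inE; case: eqP => [x0|x0].
      by rewrite (_ : x == ord0) //; apply/eqP/val_inj.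
    have [_ _ ->] := arrE x (ltn_ord x).
    by case: eqP => // x0'; rewrite x0' in x0.
  + by case.
- split => //=; rewrite ?big_pred0 //.
- by move=> i s' [[-> _ _ _ _] -> _ _ _].
move=> i s' _ lt [inp' iE oE slackE arrE]; apply: runs_straight => //=.
rewrite /upd /= iE; split => //; split=> //=; rewrite /upd /=.
- by rewrite oE; case: inp' => -> _ _ _ _; rewrite mulSn addnC.
- rewrite slackE [RHS](bigD1 (Ordinal lt)) //= addrC; congr (_ + _).
    by apply: eq_bigl => v; rewrite -val_eqE /= ltnS andbC -ltn_neqAle.
  by have [_ _ <- _ _] := inp'.
- move=> x; rewrite ltnS leq_eqVlt => /predU1P[->|xi]; first by rewrite eqxx oE.
  by have [-> -> ->] := arrE x xi; rewrite (ltn_eqF xi).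
Qed.

Lemma attached_root : grown [:: ord0] (fun=> ord0).
Proof.
split; first exact: PrimRoot.
by move=> y _; split=> [|x]; rewrite inE // => /eqP->.
Qed.

Lemma select_spec i s os par : attached par os -> (size os < n)%N ->
  tree_state s os par -> nreg s 2 = i -> nreg s 4 = 0%N ->
  runs n (For 3 0 select_body) s (fun s' =>
    [/\ tree_state s' os par, nreg s' 2 = i & exists v : 'I_n, [/\ nreg s' 4 = v,
       v \notin os & forall y, y \notin os -> pkey I par v <= pkey I par y]]).
Proof.
move=> at_ sz ts iE vE.
(* Until an unvisited vertex is met, [v] is the visited dummy 0; hence both claims about [v] are
   conditional on some unvisited [y]. *)
pose P j s := [/\ tree_state s os par, nreg s 2 = i, nreg s 3 = j
  & exists v : 'I_n, nreg s 4 = v /\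
    forall y : 'I_n, (y < j)%N -> y \notin os ->
      v \notin os /\ pkey I par v <= pkey I par y].
apply: runs_mono (@runs_for _ n 3 0 select_body P _ _ _ _ _) => //.
- move=> s' [ts' iE' _ [v [vE' min]]]; split=> //; exists v; split=> //.
    have [y yos] : exists y, y \notin os.
      apply/existsP; apply: contraTT sz => /existsPn all.
      rewrite -leqNgt -[leqLHS]card_ord; apply: leq_trans (card_size os).
      by apply/subset_leq_card/subsetP => x _; have := all x; rewrite negbK.
    by have [] := min y (ltn_ord y) yos.
  by move=> y; have := min y (ltn_ord y) => h /h[].
- by split => //; exists ord0; split.
- by move=> j s' [[/loaded_n -> _ _ _ _] _ -> _].
move=> j s' _ lt [ts' iE' jE [v [vE' min]]]; apply: runs_straight => //=.
have [ld _ pE visE _] := ts'; pose y := Ordinal lt.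
have visj : (narr s' 4 (nreg s' 3) <= 0)%N = (y \notin os).
  by rewrite jE -[j]/(nat_of_ord y) visE; case: (_ \in _).
have visv : (narr s' 4 (nreg s' 4) <= 0)%N = (v \notin os).
  by rewrite vE' visE; case: (_ \in _).
have jS (z : 'I_n) : (z < j.+1)%N -> z = y \/ (z < j)%N.
  by rewrite ltnS leq_eqVlt => /predU1P[zj|->]; [left; apply/val_inj|right].
have keep : y \in os -> P j.+1 (set_nreg s' 3 j.+1).
  move=> yos; split=> //; exists v; split=> // z zj zos.
  by have [E|] := jS z zj; [rewrite E yos in zos | move/min; apply].
rewrite visj; case: ifPn => [yos|]; last by rewrite negbK => /keep.
have pick : (forall z : 'I_n, (z < j)%N -> z \notin os -> pkey I par y <= pkey I par z) ->
    P j.+1 (set_nreg (set_nreg s' 4 (nreg s' 3)) 3 j.+1).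
  move=> miny; split=> //; exists y; rewrite /= /upd /= jE; split=> // z zj zos.
  by split=> //; have [->|/miny] := jS z zj; [| apply].
rewrite visv; case: ifPn => [vos|]; last first.
  rewrite negbK => vos; split=> //; apply: pick => z zj zos.
  by have [] := min z zj zos; rewrite vos.
have /= -> := reval_pkey (e := NReg 3) (v := y) ld pE jE (attached_neq at_ yos).
have /= -> := reval_pkey (e := NReg 4) (v := v) ld pE vE' (attached_neq at_ vos).
case: ifPn => le; split=> //.
  apply: pick => z zj zos; apply: le_trans le _.
  by have [] := min z zj zos.
split=> //; exists v; split=> // z zj zos; split=> //.
have [->|/min h] := jS z zj; last by have [] := h zos.
by rewrite ltW // ltNge.
Qed.

(** [v] is already marked visited, whereas the tentative parents are still those for [behead os]. *)
Lemma relax_spec i s os par (v : 'I_n) (par' := fun y =>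
    if (y \notin os) && (key I v y <= key I (par y) y) then v else par y) :
  attached par (behead os) -> v \in os ->
  (forall y, y \notin os -> y \notin behead os) ->
  tree_state s os par -> nreg s 2 = i -> nreg s 4 = v ->
  runs n (For 3 0 relax_body) s (fun s' => tree_state s' os par' /\ nreg s' 2 = i).
Proof.
move=> at_ vos sub ts iE vE.
pose P j s := [/\ loaded s, rreg s 1 = slack I, vis_state s os, ord_state s os
  & [/\ nreg s 2 = i, nreg s 4 = v, nreg s 3 = j
    & forall y : 'I_n, narr s 3 y = if (y < j)%N then par' y else par y]].
apply: runs_mono (@runs_for _ n 3 0 relax_body P _ _ _ _ _) => //.
- move=> s' [ld sl visE ordE [iE' _ _ pE]]; split=> //; split=> // y.
  by rewrite pE ltn_ord.
- by case: ts.
- by move=> j s' [/loaded_n -> _ _ _ [_ _ -> _]].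
move=> j s' _ lt [ld sl visE ordE [iE' vE' jE pE]]; apply: runs_straight => //=.
pose y := Ordinal lt.
have visj : (narr s' 4 (nreg s' 3) <= 0)%N = (y \notin os).
  by rewrite jE -[j]/(nat_of_ord y) visE; case: (_ \in _).
have jS (z : 'I_n) : (z < j.+1)%N = (z == y) || (z < j)%N.
  by rewrite ltnS leq_eqVlt.
have cond : (narr s' 4 (nreg s' 3) <= 0)%N &&
    (reval s' (Ekey (NReg 4) (NReg 3)) <= reval s' (Epkey (NReg 3))) =
    (y \notin os) && (key I v y <= key I (par y) y).
  rewrite visj; case: (boolP (y \in os)) => //= yos; congr (_ <= _).
    apply: (@reval_key s' (NReg 4) (NReg 3) v y) => //.
    by apply: contraNneq yos => <-.
  apply: (@reval_key s' (NGet 3 (NReg 3)) (NReg 3) (par y) y) => //.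
    by rewrite /= jE -[j]/(nat_of_ord y) pE /= ltnn.
  by apply: attached_neq at_ _; exact: sub.
rewrite /= in cond; rewrite cond; case: ifPn => h; split=> //; split=> //; split=> //=.
  move=> z; rewrite /upd /= /upd jE vE' jS (_ : (nat_of_ord z == j) = (z == y)) //.
  case: eqP => [->|_] /=; last exact: pE.
  by rewrite /par' h.
move=> z; rewrite jS pE; case: eqP => [->|//] /=.
by rewrite ltnn /par' (negbTE h).
Qed.

Lemma prim_step_spec i s os par : grown os par -> size os = i -> (i < n)%N ->
  tree_state s os par -> nreg s 2 = i ->
  runs n prim_body s (fun s' => exists os' par',
    [/\ grown os' par', size os' = i.+1, tree_state s' os' par' & nreg s' 2 = i]).
Proof.
move=> [pos at_] sz lt ts iE.
apply: runs_seq; apply: runs_straight => //; apply: runs_seq.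
have [ld sl pE visE ordE] := ts.
apply: runs_mono (select_spec (i := i) at_ _ _ _ _) => //; last by rewrite sz.
move=> {ld sl pE visE ordE} s1 [[ld sl pE visE ordE] iE1 [v [vE vos min]]].
apply: runs_seq; apply: runs_straight => //.
have [pvos minv] := at_ v vos.
pose os' := v :: os; pose par' y :=
  if (y \notin os') && (key I v y <= key I (par y) y) then v else par y.
(* Tentative parents are nearest visited vertices, so the least tentative key is least among all
   crossing pairs. *)
have step x y : x \in os -> y \notin os -> key I (par v) v <= key I x y.
  move=> xos yos; apply: le_trans (min y yos) _.
  by have [_] := at_ y yos; apply.
have par_eq : {in os', par =1 par'} by move=> x xos; rewrite /par' xos.
apply: runs_mono (@relax_spec i _ os' par v _ _ _ _ _ _) => //.
- move=> s2 [ts2 iE2]; exists os', par'; split=> //=; last by rewrite sz.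
  split; first by apply: (prim_eq_in par_eq); exact: PrimStep.
  move=> y yos'; have := yos'; rewrite in_cons negb_or => /andP[yv yos].
  have [pyos miny] := at_ y yos; rewrite /par' yos' /=.
  case: ifPn => [le|lt']; split; rewrite ?in_cons ?eqxx ?pyos ?orbT //.
    by move=> x /predU1P[->//|/miny]; apply: le_trans.
  move=> x /predU1P[->|/miny//].
  by rewrite ltW // ltNge.
- exact: mem_head.
- by move=> y; rewrite in_cons negb_or => /andP[].
split=> //=.
- move=> x; rewrite /= /upd /= vE (_ : (nat_of_ord x == v) = (x == v)) // in_cons.
  by case: eqP => // _; exact: visE.
move=> j; rewrite /= /upd /= ltnS iE1 rev_cons nth_rcons size_rev sz.
rewrite leq_eqVlt => /predU1P[->|ji]; first by rewrite eqxx ltnn vE.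
by rewrite ltn_eqF // ji ordE // sz.
Qed.

Lemma prim_spec s : tree_state s [:: ord0] (fun=> ord0) ->
  runs n (For 2 1 prim_body) s (fun s' => exists os par,
    [/\ prim I par os, size os = n & tree_state s' os par]).
Proof.
move=> ts; pose P i s := exists os par,
  [/\ grown os par, size os = i, tree_state s os par & nreg s 2 = i].
apply: runs_mono (@runs_for _ n 2 1 prim_body P _ _ _ _ _) => //.
- by move=> s' [os [par [[pos _] sz ts' _]]]; exists os, par.
- by exists [:: ord0], (fun=> ord0); split=> //; exact: attached_root.
- by move=> i s' [os [par [_ _ [/loaded_n -> _ _ _ _] ->]]].
move=> i s' _ lt [os [par [gr sz ts' iE]]].
apply: runs_mono (prim_step_spec gr sz lt ts' iE) => s2 [os' [par' [gr' sz' ts2 iE2]]].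
by split=> //; exists os', par'.
Qed.

Definition start_state s (par : 'I_n -> 'I_n) :=
  forall x : 'I_n, narr s 6 x = ~~ kept I par x.

Lemma prefix_spec i s os par (v : 'I_n) : (forall y, y != ord0 -> par y != y) ->
  v = i :> nat -> v != ord0 -> tree_state s os par -> nreg s 2 = i ->
  rreg s 2 = slack I ->
  runs n (For 3 1 prefix_body) s (fun s' =>
    [/\ tree_state s' os par, nreg s' 2 = i, narr s' 6 = narr s 6 & rreg s' 2 =
      slack I + \sum_(j | (j != ord0) && before I par j v) (1 + elod I (par j) j)]).
Proof.
move=> pn vi v0 ts iE accE.
pose P j s1 := [/\ tree_state s1 os par, nreg s1 2 = i, nreg s1 3 = j,
    narr s1 6 = narr s 6
  & rreg s1 2 = slack I + \sum_(y : 'I_n | [&& y != ord0, before I par y v & (y < j)%N])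
      (1 + elod I (par y) y)].
apply: runs_mono (@runs_for _ n 3 1 prefix_body P _ _ _ _ _) => //.
- move=> s' [ts' iE' _ arrE ->]; split=> //; congr (_ + _).
  by apply: eq_bigl => y; rewrite ltn_ord andbT.
- split=> //=; rewrite accE big_pred0 ?addr0 // => y; rewrite ltnS leqn0.
  by rewrite (_ : (nat_of_ord y == 0)%N = (y == ord0)) //; case: (y == ord0); rewrite ?andbF.
- by move=> j s' [[/loaded_n -> _ _ _ _] _ ->].
move=> j s' j1 lt [ts' iE' jE arrE accE']; apply: runs_straight => //=.
have [ld sl pE visE ordE] := ts'; pose y := Ordinal lt.
have y0 : y != ord0 by apply: contraTneq j1 => /(congr1 val) /= ->.
have jS (z : 'I_n) : (z < j.+1)%N = (z == y) || (z < j)%N.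
  by rewrite ltnS leq_eqVlt.
have /= jkey := reval_pkey (e := NReg 3) (v := y) ld pE jE (pn _ y0).
have vr : nreg s' 2 = v by rewrite vi.
have /= vkey := reval_pkey (e := NReg 2) ld pE vr (pn _ v0).
have pyE : narr s' 3 (nreg s' 3) = par y by rewrite jE -[j]/(nat_of_ord y) pE.
have /= jlod := @reval_lod s' (NGet 3 (NReg 3)) (NReg 3) (par y) y ld pyE jE (pn _ y0).
rewrite jkey vkey jlod vr jE -/(before I par y v).
have sumE (f : 'I_n -> R) :
    \sum_(z : 'I_n | [&& z != ord0, before I par z v & (z < j.+1)%N]) f z =
    \sum_(z : 'I_n | [&& z != ord0, before I par z v & (z < j)%N]) f z +
    (if before I par y v then f y else 0).
  rewrite (bigID (pred1 y)) /= addrC; congr (_ + _).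
    apply: eq_bigl => z; rewrite /= jS; case: (z =P y) => [->|_] /=; last by rewrite andbT.
    by rewrite ltnn !andbF.
  case: ifPn => yv; last first.
    by rewrite big_pred0 // => z; rewrite /=; case: (z =P y) => [->|]; rewrite ?andbF // (negbTE yv) andbF.
  rewrite (big_pred1 y) // => z; rewrite /= jS.
  by case: (z =P y) => [->|]; rewrite ?andbF // y0 yv.
case: ifPn => yv; split=> //; split=> //=; rewrite sumE.
  by rewrite yv [RHS]addrA -accE'.
by rewrite (negbTE yv) addr0.
Qed.

Lemma keep_spec s os par : prim I par os -> size os = n -> tree_state s os par ->
  runs n keep_prog s (fun s' => tree_state s' os par /\ start_state s' par).
Proof.
move=> pos sz ts.
have full := prim_full pos sz.
have pn v : v != ord0 -> par v != v by apply: prim_par_neq pos _.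
pose P i s := [/\ tree_state s os par, nreg s 2 = i
  & forall x : 'I_n, (x < i)%N -> narr s 6 x = ~~ kept I par x].
apply: runs_seq; apply: runs_straight => //.
apply: runs_mono (@runs_for _ n 2 1 keep_body P _ _ _ _ _) => //.
- by move=> s' [ts' _ st]; split=> // x; apply: st.
- split=> // x; rewrite ltnS leqn0 /= /upd /= => /eqP x0.
  have -> : x = ord0 by exact/val_inj.
  by rewrite /kept eqxx.
- by move=> i s' [[/loaded_n -> _ _ _ _] ->].
move=> i s' i0 lt [ts' iE st]; pose v := Ordinal lt.
have v0 : v != ord0 by apply: contraTneq i0 => /(congr1 val) /= ->.
apply: runs_seq; apply: runs_straight => //; apply: runs_seq.
have sl' : rreg s' 1 = slack I by case: ts'.
apply: runs_mono 
  (@prefix_spec i (sem (RSet 2 (RReg 1)) s') os par v pn erefl v0 ts' iE sl').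
move=> s1 [ts1 iE1 arrE accE]; have [ld sl pE visE ordE] := ts1.
apply: runs_straight => //=.
have pvE : narr s1 3 (nreg s1 2) = par v by rewrite iE1 -[i]/(nat_of_ord v) pE.
have vE : nreg s1 2 = v by [].
have /= cE := @reval_cst s1 (NGet 3 (NReg 2)) (NReg 2) (par v) v ld pvE vE (pn _ v0).
have gE : rreg s1 0 = opening I by case: ld => [[]].
rewrite cE gE accE; set b := _ && _.
have {}bE : b = kept I par v by rewrite /kept v0.
have post (w : nat) : w = ~~ kept I par v -> P i.+1 (set_nreg (set_narr s1 6 (nreg s1 2) w) 2 i.+1).
  move=> wE; split=> // x; rewrite ltnS leq_eqVlt /= /upd /= iE1 arrE.
  have [xi _|xi /= lti] := eqVneq (x : nat) i; last exact: st.
  by rewrite wE (_ : x = v) //; apply/val_inj.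
by rewrite bE; case: ifPn => k; (split; first exact: iE1); apply: post; rewrite k.
Qed.

(** Leaves the successor of the last vertex free, as that cell may hold anything. *)
Definition chain (f : nat -> nat) (ws : seq 'I_n) :=
  sorted (fun x y : 'I_n => f x == y) ws.

Lemma chain_eq (f g : nat -> nat) (x : 'I_n) t y : {in x :: t, forall z : 'I_n, f z = g z} ->
  chain f (x :: rcons t y) -> chain g (x :: rcons t y).
Proof.
rewrite /chain /=; elim: t x => /= [|z t IH] x eq.
  by rewrite !andbT eq ?mem_head.
case/andP=> fx pt; rewrite -eq ?mem_head // fx; apply: IH pt => w wt.
by apply: eq; rewrite in_cons wt orbT.
Qed.

Lemma chain_cat f A p C :
  chain f (A ++ p :: C) = chain f (rcons A p) && chain f (p :: C).
Proof. by case: A => //= x A; rewrite /chain /= -cat_rcons cat_path last_rcons. Qed.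

(** The updates are nested in program order; the links inside [A] and [B] read neither changed
    cell. *)
Lemma chain_insert f A (p v : 'I_n) B : uniq (A ++ p :: B) -> v \notin A ++ p :: B ->
  chain f (A ++ p :: B) -> chain (upd (upd f v (f p)) p v) (A ++ p :: v :: B).
Proof.
set g := upd _ _ _; move=> un vn; rewrite !chain_cat => /andP[chA chB].
have pv : p != v by apply: contraNneq vn => ->; rewrite mem_cat mem_head orbT.
have gE (z : 'I_n) : z != p -> z != v -> g z = f z.
  by move=> zp zv; rewrite /g /upd !(inj_eq val_inj) (negbTE zp) (negbTE zv).
have gp : g p = v by rewrite /g /upd eqxx.
have gv : g v = f p.
  by rewrite /g /upd (inj_eq val_inj) eq_sym (negbTE pv) eqxx.
have same (z : 'I_n) : z \in A ++ p :: B -> z != p -> f z = g z.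
  by move=> zin zp; rewrite gE //; apply: contraNneq vn => <-.
move: un; rewrite cat_uniq => /and3P[_ /hasPn dis /andP[pB _]].
apply/andP; split.
  case: A same dis chA {vn} => //= x A same dis; apply: chain_eq => z zA.
  by apply: same; rewrite -?cat_cons ?mem_cat ?zA //;
    apply: contraTneq zA => ->; apply: dis; exact: mem_head.
rewrite /chain /= gp eqxx /=; case: B same chB pB {vn dis} => //= y B same.
rewrite /chain /= gv => /andP[-> pB] pyB /=.
case/lastP: B pB same pyB => // B w pB same pyB.
apply: (chain_eq (x := y)) pB => z zB; apply: same.
  by rewrite mem_cat !in_cons mem_rcons in_cons; move: zB; rewrite in_cons => /orP[->|->]; rewrite /= ?orbT.
apply: contraNneq pyB => <-; move: zB; rewrite !in_cons mem_rcons in_cons.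
by case/orP=> ->; rewrite /= ?orbT.
Qed.

Lemma chain_head f (v : 'I_n) ws : v \notin ws -> chain f ws ->
  chain (upd f v (head ord0 ws)) (v :: ws).
Proof.
move=> vws ch; rewrite /chain; case: ws vws ch => //= x t vxt.
set g := upd _ _ _; have -> : g v = x by rewrite /g /upd eqxx.
rewrite eqxx /=; case/lastP: t vxt => // t y vxt ch.
apply: (@chain_eq f g x t y) ch => z zt; rewrite /g /upd (inj_eq val_inj).
case: eqP => // zv.
case/negP: vxt; rewrite -zv in_cons mem_rcons in_cons.
by move: zt; rewrite in_cons => /orP[->|->]; rewrite /= ?orbT.
Qed.

Lemma prim_cons par v os : prim I par (v :: os) -> os != [::] ->
  [/\ prim I par os, v \notin os & par v \in os].
Proof.
move E: (v :: os) => vs pvs; case: pvs E => [[_ ->] //|os' w ? ? ? _ [-> ->] _].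
by split.
Qed.

Lemma prim_cat par a b : prim I par (a ++ b) -> b != [::] -> prim I par b.
Proof.
elim: a => //= x a IH pos b0; apply: IH => //.
by have [] := prim_cons pos; first by case: (a) b0.
Qed.

Lemma layout_spec s os par : prim I par os -> size os = n ->
  tree_state s os par -> start_state s par ->
  runs n layout_prog s (fun s' => [/\ loaded s', start_state s' par,
    chain (narr s' 7) (layout I par os) & nreg s' 5 = head ord0 (layout I par os)]).
Proof.
move=> pos sz [ld _ pE _ ordE] st.
(* Array 5 holds the reverse of [os], so the loop consumes [os] from its right end. *)
pose P i s := exists a b, [/\ os = a ++ b, size b = i, prim I par b
  & [/\ loaded s, start_state s par, par_state s par, ord_state s os
  & [/\ nreg s 2 = i, chain (narr s 7) (layout I par b)
      & nreg s 5 = head ord0 (layout I par b)]]].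
apply: runs_seq; apply: runs_straight => //.
apply: runs_mono (@runs_for _ n 2 1 layout_body P _ _ _ _ _) => //.
- move=> s' [a [b [E szb _ [ld' st' _ _ [_ ch hd]]]]].
  suff a0 : a = [::] by move: E; rewrite a0 => ->.
  apply/nilP; rewrite /nilp; have := congr1 size E; rewrite size_cat szb sz.
  by move=> /eqP; rewrite -{1}[n]add0n eqn_add2r eq_sym.
- have [a Ea] : exists a, os = rcons a ord0.
    elim: pos {sz ordE} => [|os' v _ [a ->] _ _ _]; first by exists [::].
    by exists (v :: a).
  exists a, [:: ord0]; split=> //; rewrite ?cats1 //; first exact: PrimRoot.
- by move=> i s' [a [b [_ _ _ [/loaded_n -> _ _ _ [-> _ _]]]]].
move=> i s' _ lt [a [b [E szb posb [ld' st' pE' ordE' [iE ch hd]]]]].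
have [a' [v Ea]] : exists a' v, a = rcons a' v.
  case/lastP: a E => [|a' v] E; last by exists a', v.
  by move: lt; rewrite -szb -[b]/([::] ++ b) -E sz ltnn.
have {}E : os = a' ++ v :: b by rewrite E Ea cat_rcons.
have posv : prim I par (v :: b) by apply: (@prim_cat _ a'); rewrite -?E.
have vE : narr s' 5 i = v.
  rewrite ordE' ?sz // E rev_cat rev_cons nth_cat size_rcons size_rev szb ltnSn.
  by rewrite nth_rcons size_rev szb ltnn eqxx.
have [vb pvb] : v \notin b /\ par v \in b.
  by have [|] := prim_cons posv; first by case: (b) posb => // /prim_root.
have pl := perm_layout posb; set ws := layout I par b in ch hd pl.
have uws : uniq ws by rewrite (perm_uniq pl) (prim_uniq posb).
have vws : v \notin ws by rewrite (perm_mem pl).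
have pvws : par v \in ws by rewrite (perm_mem pl).
apply: runs_straight => //=; rewrite /upd /= iE vE st'.
have [kv|kv] := boolP (kept I par v); split=> //; exists a', (v :: b); split=> //=;
  rewrite ?szb //; split=> //; split=> //=; rewrite ?kv ?(negbTE kv) -/ws.
- case/splitPr: pvws uws vws ch {pl hd} => A B uws vws ch.
  rewrite (insert_after_cat _ _ _); last first.
    by move: uws; rewrite cat_uniq /= negb_or => /and3P[_ /andP[]].
  have := chain_insert uws vws ch; rewrite -pE'; exact.
- by have [h [t [Ews _]]] := layout_cons posb; rewrite /upd /= hd /ws Ews.
- have := chain_head vws ch; rewrite -hd; exact.
- by [].
Qed.

Lemma chain_next f ss h t x rest :
  chain f (verts (rcons ss (h, t)) ++ x :: rest) -> f (last h t) = x.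
Proof.
rewrite /verts map_rcons flatten_rcons -catA /seg_verts /= /chain => /cat_sorted2[_] /=.
by rewrite cat_path /= => /and3P[_ /eqP].
Qed.

Definition edges_state s (l : seq ('I_n * 'I_n)) :=
  [seq (narr s 0 i, narr s 1 i) | i <- iota 0 (nreg s 1)] = [seq (val e.1, val e.2) | e <- l].

Lemma edges_put s l (v x : 'I_n) (s' := set_nreg (set_narr (set_narr s 0 (nreg s 1) v) 1 (nreg s 1) x) 1 (nreg s 1).+1) :
  edges_state s l -> edges_state s' (rcons l (v, x)).
Proof.
rewrite /edges_state map_rcons -cats1 => <-.
have -> : nreg s' 1 = (nreg s 1 + 1)%N by rewrite addn1.
rewrite iotaD map_cat.
rewrite /= /upd /= !eqxx; congr (_ ++ _); apply/eq_in_map => i.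
by rewrite mem_iota add0n => /= /ltn_eqF->.
Qed.

Lemma scan_spec s par os (ws := layout I par os) : prim I par os -> size os = n ->
  loaded s -> start_state s par -> chain (narr s 7) ws -> nreg s 5 = head ord0 ws ->
  runs n scan_prog s (fun s' => exists ss h t,
    [/\ scanned I par ws ss h t [::] (rreg s' 3), nreg s' 0 = (size ss).+1
      & edges_state s' (all_links (rcons ss (h, t)))]).
Proof.
move=> pos sz ld st ch hd.
(* The first vertex is read before the loop, which starts at 1, so [i] counts the vertices read. *)
pose P i s := exists ss h t rest,
  [/\ scanned I par ws ss h t rest (rreg s 3), size rest = (n - i)%N,
      edges_state s (all_links (rcons ss (h, t)))
    & [/\ loaded s, start_state s par, chain (narr s 7) ws
    & [/\ nreg s 2 = i, nreg s 4 = last h t & nreg s 6 = (size ss).+1]]].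
have [h0 [t0 [E0 h0k]]] := layout_cons pos.
have pl := perm_layout pos; have uws : uniq ws by rewrite (perm_uniq pl) (prim_uniq pos).
have szt : size t0 = n' by apply/succn_inj; move: sz; rewrite -(perm_size pl) E0.
apply: runs_seq; apply: runs_straight => //; apply: runs_seq.
apply: runs_mono (@runs_for _ n 2 1 scan_body P _ _ _ _ _) => //.
- move=> s' [ss [h [t [rest [scd szr edg [_ _ _ [_ _ kE]]]]]]]; apply: runs_straight => //.
  by exists ss, h, t; split=> //; move: szr scd; rewrite subnn => /size0nil->.
- have hE : nreg s 5 = h0 by rewrite hd /ws E0.
  have bE : rarr s 0 (nreg s 5) = vload I h0 by exact: (@reval_vload s (NReg 5) h0 ld hE).
  exists [::], h0, [::], t0; split=> //=; last by rewrite szt subn1.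
  by rewrite /upd /= /upd /= bE /ws E0; exact: scanned_init.
- by move=> i s' [ss [h [t [rest [_ _ _ [/loaded_n -> _ _ [-> _ _]]]]]]].
move=> i s' i1 lt [ss [h [t [rest [scd szr edg [ld' st' ch' [iE vE kE]]]]]]].
case: rest scd szr => [|x rest] scd szr.
  by move: szr => /= /eqP; rewrite eq_sym subn_eq0 leqNgt lt.
have Ews : verts (rcons ss (h, t)) ++ x :: rest = ws by case: scd.
have nx : narr s' 7 (nreg s' 4) = x by rewrite vE; apply: (@chain_next _ ss h t x rest); rewrite Ews.
have nehx : last h t != x.
  move: uws; rewrite -Ews /verts map_rcons flatten_rcons -catA cat_uniq.
  case/and3P=> _ _; rewrite -[seg_verts _]/(h :: t) cat_uniq => /and3P[_ /hasPn dis _].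
  by apply: contraNneq (dis x (mem_head _ _)) => <-; exact: mem_last.
have szr' : size rest = (n - i.+1)%N by rewrite subnS -szr.
have uE : rarr s' 2 (narr s' 2 (last h t) + x)%N = elod I (last h t) x.
  by case: ld' => [[_ _ _ _ uE] rowE]; rewrite rowE uE.
have bE : rarr s' 0 x = vload I x by case: ld' => [[_ _ -> _ _] _].
have kE' : (narr s' 6 x <= 0)%N = kept I par x by rewrite st'; case: (kept _ _ _).
apply: runs_straight => //=; rewrite /upd /= /upd /= nx vE uE bE kE'.
split; first by case: ifP.
case: ifPn => cond; rewrite ?addn1.
  have [xk fits] := andP cond.
  exists ss, h, (rcons t x), rest; split=> //=; rewrite ?last_rcons //.
    exact: scanned_extend nehx xk fits scd.
  have -> : all_links (rcons ss (h, rcons t x)) =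
      rcons (all_links (rcons ss (h, t))) (last h t, x).
    by rewrite /all_links !map_rcons !flatten_rcons /seg_links /= links_rcons rcons_cat.
  exact: (edges_put (last h t) x edg).
exists (rcons ss (h, t)), x, [::], rest; split=> //=.
- exact: scanned_cut nehx cond scd.
- have -> : all_links (rcons (rcons ss (h, t)) (x, [::])) = all_links (rcons ss (h, t)).
    by rewrite /all_links [in LHS]map_rcons flatten_rcons /seg_links /= cats0.
  exact: edg.
- by split=> //; split=> //=; rewrite size_rcons /upd /= kE.
Qed.

Lemma approx_spec s : input I s ->
  runs n approx_prog s (fun s' => exists S : solution n,
    [/\ output s' S, feasible I S
      & forall Sopt, feasible I Sopt -> cost I S <= 3 * cost I Sopt]).
Proof.
move=> inp; apply: runs_seq; apply: runs_mono (init_spec inp) => s1 ts1.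
apply: runs_seq; apply: runs_mono (prim_spec ts1) => s2 [os [par [pos sz ts2]]].
apply: runs_seq; apply: runs_mono (keep_spec pos sz ts2) => s3 [ts3 st3].
apply: runs_seq; apply: runs_mono (layout_spec pos sz ts3 st3) => s4 [ld4 st4 ch4 hd4].
apply: runs_mono (scan_spec pos sz ld4 st4 ch4 hd4) => s5 [ss [h [t [scd kE edg]]]].
have [un feas apx] := scanned_approx wfI pos sz scd.
exists (Solution (size (rcons ss (h, t)))
  [set e | e \in link_edges (all_links (rcons ss (h, t)))]).
split=> //; split; first by rewrite kE /= size_rcons.
by exists (all_links (rcons ss (h, t))); split.
Qed.

End Correctness.

(** * Quadratic time is within the bound m log n *)

Lemma time_bound_approx n : (0 < n)%N -> (time_bound n approx_prog <= 1000 * (n * n))%N.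
Proof.
(* Loops nest at most two deep, so the bound computes to a quadratic polynomial whose coefficients
   sum to at most 1000. *)
move=> n0; rewrite /=.
have : (n <= n * n)%N by rewrite leq_pmulr.
have : (1 <= n * n)%N by rewrite muln_gt0 n0.
lia.
Qed.

(** This is ln (1 + x) <= x at x = -1/2. *)
Lemma half_le_ln2 (R : realType) : 2^-1 <= ln 2 :> R.
Proof.
have := @le_ln1Dx R (- 2^-1); rewrite (_ : 1 + - 2^-1 = 2^-1); last by lra.
by rewrite lnV ?posrE // => h; have := h ltac:(lra); lra.
Qed.

(** For n >= 2, m = n (n - 1) / 2 gives n^2 <= 4 m, and ln n >= 1/2 contributes the remaining factor
    2. *)
Lemma sqr_le_m_log_n (R : realType) n : (0 < n)%N -> (n * n)%:R <= 8 * m_log_n R n.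
Proof.
rewrite /m_log_n; case: n => [|[|n]] // _.
  have : 1 <= Num.max 1 (#|edges 1|%:R * ln 1%:R) :> R by rewrite le_max lexx.
  by rewrite muln1; lra.
set N := n.+2.
have lnN : 2^-1 <= ln N%:R :> R.
  by apply: le_trans (half_le_ln2 R) _; rewrite ler_ln ?posrE ?ltr0n // (ler_nat _ 2).
have edgesE : (#|edges N| * 2 = N * N.-1)%N.
  rewrite /edges card_draws card_ord; have := bin_ffact N 2.
  by rewrite !ffactnS ffactn0 muln1.
have big : (N * N <= 4 * #|edges N|)%N by rewrite /N in edgesE *; lia.
have le : #|edges N|%:R * 2^-1 <= #|edges N|%:R * ln N%:R :> R.
  by rewrite ler_wpM2l.
have : #|edges N|%:R * ln N%:R <= Num.max 1 (#|edges N|%:R * ln N%:R) :> R.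
  by rewrite le_max lexx orbT.
have : (N * N)%:R <= 4 * #|edges N|%:R :> R by rewrite -natrM ler_nat.
lra.
Qed.

Theorem theorem1 (R : realType) :
  exists (p : cmd) (C : R),
    forall (n : nat) (I : instance R n), wf_instance I ->
    forall s : state R, input I s ->
    exists (t : nat) (s' : state R) (S : solution n),
      [/\ exec p s t s',
          output s' S,
          feasible I S,
          (forall Sopt : solution n, optimal I Sopt ->
             cost I S <= 3 * cost I Sopt)
        & t%:R <= C * m_log_n R n].
Proof.
exists approx_prog, (1000 * 8) => -[|n] I wfI s inp; first by case: wfI.
have [t [s' [ex le [S [out feas apx]]]]] := approx_spec wfI inp.
exists t, s', S; split=> //; first by move=> Sopt [/apx].
rewrite -mulrA; apply: (@le_trans _ _ (1000 * (n.+1 * n.+1)%:R)).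
  by rewrite -natrM ler_nat (leq_trans le) ?time_bound_approx.
by rewrite ler_pM2l ?sqr_le_m_log_n.
Qed.
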